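(* Let $\mathbf{X}=(X(t),t\in\mathbb{R})$ be a stationary process with upper semi-continuous sample paths, and let $T>0$. Then the restriction of the law $F_{\mathbf{X},T}$ to the interior $(0,T)$ of the interval $[0,T]$ is absolutely continuous. The density, denoted by $f_{\mathbf{X},T}$, can be taken to be equal to the right derivative of the cumulative distribution function of $F_{\mathbf{X},T}$, which exists at every point in the interval $(0,T)$. In this case the density is right continuous, has left limits, and has the following properties. (a) The limits $f_{\mathbf{X},T}(0+)=\lim_{t\to 0}f_{\mathbf{X},T}(t)$ and $f_{\mathbf{X},T}(T-)=\lim_{t\to T}f_{\mathbf{X},T}(t)$ exist. (b) The density has a universal upper bound given by $$f_{\mathbf{X},T}(t)\le\max\left(\frac1t,\frac1{T-t}\right),\qquad 0<t<T.$$ (c) Assume that the process satisfies Assumption $\mathrm{U}_T$. Then the density is bounded away from zero: $\inf_{0<t<T}f_{\mathbf{X},T}(t)>0$. (d) The density has a bounded variation away from the endpoints of the interval. Furthermore, for every $0<t_1<t_2<T$, $$\mathrm{TV}_{(t_1,t_2)}(f_{\mathbf{X},T})\le\min\bigl(f_{\mathbf{X},T}(t_1),f_{\mathbf{X},T}(t_1-)\bigr)+\min\bigl(f_{\mathbf{X},T}(t_2),f_{\mathbf{X},T}(t_2-)\bigr).$$ (e) The density has a bounded positive variation at the left endpoint and a bounded negative variation at the right endpoint. Furthermore, for every $0<\varepsilon<T$, $$\mathrm{TV}^+_{(0,\varepsilon)}(f_{\mathbf{X},T})\le\min\bigl(f_{\mathbf{X},T}(\varepsilon),f_{\mathbf{X},T}(\varepsilon-)\bigr)$$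 and $$\mathrm{TV}^-_{(T-\varepsilon,T)}(f_{\mathbf{X},T})\le\min\bigl(f_{\mathbf{X},T}(T-\varepsilon),f_{\mathbf{X},T}((T-\varepsilon)-)\bigr).$$ (f) The limit $f_{\mathbf{X},T}(0+)<\infty$ if and only if $\mathrm{TV}_{(0,\varepsilon)}(f_{\mathbf{X},T})<\infty$ for some (equivalently, any) $0<\varepsilon<T$, in which case $$\mathrm{TV}_{(0,\varepsilon)}(f_{\mathbf{X},T})\le f_{\mathbf{X},T}(0+)+\min\bigl(f_{\mathbf{X},T}(\varepsilon),f_{\mathbf{X},T}(\varepsilon-)\bigr).$$ Similarly, $f_{\mathbf{X},T}(T-)<\infty$ if and only if $\mathrm{TV}_{(T-\varepsilon,T)}(f_{\mathbf{X},T})<\infty$ for some (equivalently, any) $0<\varepsilon<T$, in which case $$\mathrm{TV}_{(T-\varepsilon,T)}(f_{\mathbf{X},T})\le\min\bigl(f_{\mathbf{X},T}(T-\varepsilon),f_{\mathbf{X},T}((T-\varepsilon)-)\bigr)+f_{\mathbf{X},T}(T-).$$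
   Context: The process $\mathbf{X}$ is real-valued and defined on a probability space $(\Omega,\mathcal{F},P)$. Since its sample paths are upper semi-continuous, the process is bounded from above on any compact interval and its supremum over that interval is attained. $\tau_{\mathbf{X},T}=\min\{t\in[0,T]: X(t)=\sup_{0\le s\le T}X(s)\}$ is the leftmost location of the supremum over $[0,T]$; it is a random variable, and $F_{\mathbf{X},T}$ denotes its law, a probability measure on $[0,T]$ (which may have atoms at $0$ and $T$). Assumption $\mathrm{U}_T$: $P(\Omega_T)=0$, where $\Omega_T$ is the event that $X(t_i)=\sup_{0\le t\le T}X(t)$, $i=1,2$, for at least two different $t_1,t_2\in[0,T]$. For $0\le a<b\le T$ and a function $f$ on $(0,T)$: $\mathrm{TV}_{(a,b)}(f)=\sup\sum_{i=1}^{n-1}|f(s_{i+1})-f(s_i)|$ is the total variation of $f$ on $(a,b)$, and $\mathrm{TV}^{\pm}_{(a,b)}(f)=\sup\sum_{i=1}^{n-1}\bigl(f(s_{i+1})-f(s_i)\bigr)_{\pm}$ is the positive (negative) variation of $f$ on $(a,b)$, the suprema being over all choices of $a<s_1<\cdots<s_n<b$; here $x_+=\max(x,0)$ and $x_-=\max(-x,0)$. $f(t-)$ denotes the left limit of $f$ at $t$. The limits in (a) are understood in $[0,\infty]$.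
   Formalization: ''Stationary'' is taken as shift invariance of the law of the whole path, with suprema over compact intervals measurable; invariance of finite-dimensional distributions alone fails: X(t)=1{t=U}, U Cantor-distributed, gives a singular law. *)

(* Defs.v *)
From HB Require Import structures.
From mathcomp Require Import all_boot all_order all_algebra finmap.
From mathcomp Require Import all_classical all_reals all_analysis.
From mathcomp Require Import measurable_realfun.
Import Order.TTheory GRing.Theory Num.Theory.
Import numFieldNormedType.Exports.

Set Implicit Arguments.
Unset Strict Implicit.
Unset Printing Implicit Defensive.

Local Open Scope classical_set_scope.
Local Open Scope ring_scope.

Definition upper_semicontinuous {R : realType} (f : R -> R) : Prop :=
  forall x a, f x < a -> \forall y \near x, f y < a.

(** For upper semi-continuous [f], [hits a b c f] says that the supremum of
    [f] over [[a, b]] is at least [c]. *)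
Definition hits {R : realType} (a b c : R) : set (R -> R) :=
  [set f | exists2 t, a <= t <= b & c <= f t].

(** On upper semi-continuous functions this is the Borel sigma-algebra of the
    usual (hypograph, or sup-vague) topology. It contains the cylinder events
    (take [a = b] in [hits]) and makes the supremum over any compact interval
    measurable, which the cylinder sigma-algebra alone does not. *)
Definition path_event {R : realType} : set_system (R -> R) :=
  <<s [set A | exists a b c : R, A = hits a b c] >>.

(** A real-valued process indexed by the real line, i.e. a random element of
    the space of upper semi-continuous functions. *)
Record usc_process d (Omega : measurableType d) (R : realType) := UscProcess {
  sample_path :> Omega -> R -> R ;
  path_usc : forall w, upper_semicontinuous (sample_path w) ;
  path_measurable : forall A, path_event A -> measurable (sample_path @^-1` A) }.

Arguments path_usc {d Omega R} X w : rename.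

(** The law of the process on the path space is invariant under time shifts.
    Invariance of the finite-dimensional distributions only would not do: if
    [U] is any random variable with an atomless law, the process
    [X t := (t == U)%:R] has upper semi-continuous paths and all its
    finite-dimensional distributions are those of the zero process, while the
    leftmost location of its supremum over [[0, T]] is [U] when [0 <= U <= T]. *)
Definition stationary d (Omega : measurableType d) (R : realType)
    (P : probability Omega R) (X : usc_process Omega R) : Prop :=
  forall (h : R) (A : set (R -> R)), path_event A ->
    P [set w | A (fun t => X w (t + h))] = P [set w | A (X w)].

Definition path_sup {R : realType} (T : R) (f : R -> R) : R :=
  sup [set f s | s in `[0, T]].

Definition argsup {R : realType} (T : R) (f : R -> R) : set R :=
  [set t | 0 <= t <= T /\ f t = path_sup T f].

(** The infimum is a minimum when [f] is upper semi-continuous and [0 <= T];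
    see [tau_in] and [tau_le] below. *)
Definition tau d (Omega : measurableType d) (R : realType)
    (X : usc_process Omega R) (T : R) (w : Omega) : R :=
  inf (argsup T (X w)).

Definition assumption_U d (Omega : measurableType d) (R : realType)
    (P : probability Omega R) (X : usc_process Omega R) (T : R) : Prop :=
  P [set w | exists t1 t2, [/\ t1 != t2, argsup T (X w) t1
                                       & argsup T (X w) t2]] = 0%E.

Section usc.
Context {R : realType}.
Implicit Types (f : R -> R) (a b t T : R).

Lemma usc_max f a b : upper_semicontinuous f -> a <= b ->
  exists2 t, a <= t <= b & forall s, a <= s <= b -> f s <= f t.
Proof.
move=> uf ab; apply: contrapT => nomax.
have nx x : a <= x <= b -> exists2 y, a <= y <= b & f x < f y.
  move=> xab; apply: contrapT => ny; apply: nomax; exists x => // s sab.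
  by rewrite leNgt; apply/negP => fxs; apply: ny; exists s.
have := @segment_compact R a b; rewrite compact_cover.
move=> /(_ R `[a, b]%classic (fun y => [set x | f x < f y])) [].
- by move=> y _; rewrite openE => x /= /uf.
- move=> x /=; rewrite in_itv /= => /nx[y yab fxy]; exists y => //=.
move=> D Dab Dcov.
have Da y : y \in D -> a <= y <= b.
  by move=> /Dab; rewrite inE /= in_itv.
have aab : a <= a <= b by rewrite lexx.
have [y0 y0D _] : cover [set` D] (fun y => [set x | f x < f y]) a.
  by apply: Dcov; rewrite /= in_itv.
have : exists2 y, y \in D & forall z, z \in D -> f z <= f y.
  have key (s : seq R) : s != [::] ->
      exists2 y, y \in s & forall z, z \in s -> f z <= f y.
    elim: s => // y s IH _; have [->|/IH[m ms mmax]] := eqVneq s [::].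
      by exists y; rewrite ?mem_head// => z; rewrite inE => /eqP->.
    have [ym|my] := leP (f y) (f m).
      exists m; first by rewrite inE ms orbT.
      by move=> z; rewrite inE => /predU1P[->//|/mmax].
    exists y; first by rewrite mem_head.
    move=> z; rewrite inE => /predU1P[->//|/mmax zm].
    exact: le_trans zm (ltW my).
  have [|y yD ymax] := key (enum_fset D).
    apply/eqP => D0; have : y0 \in enum_fset D by exact: y0D.
    by rewrite D0.
  by exists y => // z /ymax.
move=> [y yD ymax].
have [z zD] : cover [set` D] (fun y => [set x | f x < f y]) y.
  by apply: Dcov; rewrite /= in_itv; exact: Da.
by rewrite /= ltNge ymax.
Qed.

Lemma path_supP f T t : upper_semicontinuous f -> 0 <= t <= T ->
  (f t = path_sup T f <-> forall s, 0 <= s <= T -> f s <= f t).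
Proof.
move=> uf tT; have T0 : 0 <= T by case/andP: tT => ? /(le_trans _) ->.
have [m mT mmax] := usc_max uf T0.
have ubf : ubound [set f s | s in `[0, T]] (f m).
  by move=> _ /= [s sT <-]; apply: mmax; move: sT; rewrite in_itv.
have -> : path_sup T f = f m.
  apply/eqP; rewrite eq_le; apply/andP; split.
    by apply: ge_sup => //; exists (f m), m => //=; rewrite in_itv.
  by apply: ub_le_sup; [exists (f m)|exists m => //=; rewrite in_itv].
split => [->//|tmax].
by apply/eqP; rewrite eq_le mmax//= tmax.
Qed.

Lemma argsup_inf f T : upper_semicontinuous f -> 0 <= T ->
  argsup T f (inf (argsup T f)).
Proof.
move=> uf T0; have [m mT mmax] := usc_max uf T0.
have mA : argsup T f m by split => //; apply/path_supP.
have hA : has_inf (argsup T f).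
  by split; [exists m|exists 0 => x [/andP[]]].
have iT : 0 <= inf (argsup T f) <= T.
  apply/andP; split.
    by apply: lb_le_inf => [|x [/andP[]]//]; exists m.
  by apply: le_trans (ge_inf hA.2 mA) _; case/andP: mT.
split => //; apply/path_supP => // s sT.
apply: le_trans (mmax _ sT) _; rewrite leNgt; apply/negP => /uf /nbhs_ballP[].
move=> e /= e0 be.
have [x [xT xs] xe] := inf_adherent e0 hA.
have ix : inf (argsup T f) <= x by apply: ge_inf => //; case: hA.
have : f x < f m.
  by apply: be; rewrite /ball /= distrC ger0_norm ?subr_ge0// ltrBlDl.
have /path_supP : 0 <= x <= T by [].
by move=> /(_ _ uf)[/(_ xs)/(_ _ mT)]; rewrite leNgt => /negP.
Qed.

End usc.

Section tau_facts.
Context d (Omega : measurableType d) (R : realType).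
Variables (X : usc_process Omega R) (T : R).

Lemma tau_in w : 0 <= T -> argsup T (X w) (tau X T w).
Proof. by move=> T0; apply: argsup_inf => //; exact: path_usc. Qed.

Lemma tau_le w t : argsup T (X w) t -> tau X T w <= t.
Proof. by move=> Tt; apply: ge_inf => //; exists 0 => x [/andP[]]. Qed.

Lemma measurable_hits a b c : measurable (X @^-1` hits a b c).
Proof.
by apply: path_measurable; apply: sub_sigma_algebra; exists a, b, c.
Qed.

Lemma measurable_tau : measurable_fun [set: Omega] (tau X T).
Proof.
have [T0|T0] := leP 0 T; last first.
  suff -> : tau X T = cst 0 by exact: measurable_cst.
  apply/funext => w; rewrite /tau (_ : argsup _ _ = set0) ?inf0//.
  apply/seteqP; split => // t [/andP[t0 tT] _].
  by have := le_lt_trans (le_trans t0 tT) T0; rewrite ltxx.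
apply: (measurability _ (RGenOInfty.measurableE R)) => //.
move=> _ [_ [r ->] <-]; rewrite setTI.
suff -> : tau X T @^-1` `]r, +oo[ = \bigcup_(q : rat)
    (X @^-1` hits 0 T (ratr q) `\` X @^-1` hits 0 (Num.min r T) (ratr q)).
  by apply: bigcupT_measurable_rat => q; apply: measurableD;
    exact: measurable_hits.
apply/seteqP; split => w /=; rewrite in_itv/= andbT.
- move=> rtau; have [tT tX] := tau_in w T0.
  have uX := path_usc X w.
  have tmax := (path_supP uX tT).1 tX.
  have tau_hits q : q <= X w (tau X T w) -> hits 0 T q (X w).
    by move=> ?; exists (tau X T w).
  have [r0|r0] := ltP r 0.
    have [q] : exists q : rat,
        ratr q \in `]X w (tau X T w) - 1, X w (tau X T w)[.
      by apply: rat_in_itvoo; rewrite ltrBlDr ltrDl.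
    rewrite in_itv/= => /andP[_ qX]; exists q => //; split.
      by apply: tau_hits; exact: ltW.
    move=> [t /andP[t0 +] _]; rewrite le_min => /andP[tr _].
    by have := le_lt_trans (le_trans t0 tr) r0; rewrite ltxx.
  have rT : r < T by apply: lt_le_trans rtau _; case/andP: tT.
  have [m /andP[m0 mr] mmax] := usc_max uX r0.
  have mT : 0 <= m <= T by rewrite m0 (le_trans mr)// ltW.
  have mtau : X w m < X w (tau X T w).
    rewrite ltNge; apply/negP => taum.
    have /tau_le : argsup T (X w) m.
      by split => //; apply/path_supP => // s /tmax/le_trans; exact.
    by rewrite leNgt (le_lt_trans mr).
  have [q] := rat_in_itvoo mtau.
  rewrite in_itv/= => /andP[mq qX]; exists q => //; split.
    by apply: tau_hits; exact: ltW.
  move=> [t /andP[t0 +] qt]; rewrite le_min => /andP[tr _].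
  have : X w t <= X w m by apply: mmax; rewrite t0.
  by rewrite leNgt (lt_le_trans mq).
- move=> [q _ [[t tT qt] nq]]; rewrite ltNge.
  apply/negP => taur; apply: nq.
  have [/[dup] tauT /andP[tau0 tauT'] tX] := tau_in w T0.
  exists (tau X T w); first by rewrite tau0 le_min taur.
  by apply: le_trans qt _; move/(path_supP (path_usc X w) tauT) : tX; exact.
Qed.

HB.instance Definition _ :=
  isMeasurableFun.Build _ _ Omega _ (tau X T) measurable_tau.

End tau_facts.

(** The law of the leftmost location of the supremum over [[0, T]]. *)
Definition tau_law d (Omega : measurableType d) (R : realType)
    (P : probability Omega R) (X : usc_process Omega R) (T : R) :
    set R -> \bar R :=
  distribution P (tau X T : {RV P >-> R}).

Definition tau_cdf d (Omega : measurableType d) (R : realType)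
    (P : probability Omega R) (X : usc_process Omega R) (T t : R) : R :=
  fine (cdf (tau X T : {RV P >-> R}) t).

Definition right_quotient {R : realType} (F : R -> R) (t h : R) : R :=
  h^-1 * (F (t + h) - F t).

Definition right_derivable {R : realType} (F : R -> R) (t : R) : Prop :=
  cvg (right_quotient F t h @[h --> 0^'+]).

Definition right_derivative {R : realType} (F : R -> R) (t : R) : R :=
  lim (right_quotient F t h @[h --> 0^'+]).

Definition left_limit {R : realType} (f : R -> R) (t : R) : R :=
  lim (f s @[s --> t^'-]).

(** Supremum of the sums of [phi (f s_(i+1) - f s_i)] over all finite
    increasing sequences of points of the open interval [(a, b)]. Unlike
    [total_variation], which is relative to [[a, b]] and uses partitions
    containing the endpoints, this never evaluates [f] at [a] or [b]. *)
Definition open_variation {R : realType} (phi : R -> R) (a b : R)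
    (f : R -> R) : \bar R :=
  ereal_sup [set (\sum_(0 <= i < (size s).-1) phi (f s`_i.+1 - f s`_i))%:E
            | s in [set s : seq R | sorted <%R s
                                    /\ forall x, x \in s -> a < x < b]].

Definition TVo {R : realType} : R -> R -> (R -> R) -> \bar R :=
  open_variation (fun x => `|x|).

Definition TVo_pos {R : realType} : R -> R -> (R -> R) -> \bar R :=
  open_variation (fun x => Num.max x 0).

Definition TVo_neg {R : realType} : R -> R -> (R -> R) -> \bar R :=
  open_variation (fun x => Num.max (- x) 0).

(* Main.v *)
From HB Require Import structures.
Require Import Defs.
From mathcomp Require Import all_boot all_order all_algebra ring lra.
From mathcomp Require Import all_classical all_reals all_analysis.
From mathcomp Require Import measurable_realfun.
Import Order.TTheory GRing.Theory Num.Theory.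
Import numFieldNormedType.Exports.

(** Let [L h] be the leftmost location of the supremum over the window
    [[h, h + T]]. By stationarity [L h - h] has the law of [tau] for every [h],
    and [L h], [L h'] coincide as soon as each of them lies in both windows.

    Cut [[0, T]] into cells of length [e] and let [p j] be the probability that
    [tau] falls into cell [j]. When the window moves by [e], the relative
    location moves one cell to the left, unless it leaves at the left end or is
    superseded by a higher point entering at the right end. Hence the positive
    part of [p (j+1) - p j] is at most the probability of being superseded in
    cell [j+1], and, as upward and downward crossings of a level are equally
    likely, the sum of these parts over [j < n] is at most [p n]. Therefore [p]
    is the sum of a nondecreasing and a nonincreasing nonnegative sequence, and
    summing and letting [e] tend to [0] along an ultrafilter writes the
    distribution function as [G + H] with [G] convex, [H] concave and both
    nondecreasing on [(0, T)]. So the density is [A + B] with [A = G'+ >= 0]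
    nondecreasing and [B = H'+ >= 0] nonincreasing, and the variation bounds
    follow from [A <= f] and [B <= f].

    If the density were not bounded away from [0], the relative location would,
    with probability close to [1], not cross a suitable level [t] while the
    window moves from [[0, T]] to [[T, 2 T]]. Staying below [t], the supremum
    over the window decreases strictly when there are no ties; staying above,
    it increases strictly. Stationarity forces the two suprema to be almost
    surely equal, a contradiction. *)

Set Implicit Arguments.
Unset Strict Implicit.
Unset Printing Implicit Defensive.

Local Open Scope classical_set_scope.
Local Open Scope ring_scope.

(** * Leftmost maximizers over moving windows *)

Section argloc.
Context {R : realType}.
Implicit Types (f : R -> R) (T h t e : R).

(** The [L h] of the overview: an absolute position, so that the maximizers of two different windows
    can be compared by an equality. *)
Definition argloc T f h : R := h + inf (argsup T (fun t => f (t + h))).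

Lemma usc_shift f h : upper_semicontinuous f ->
  upper_semicontinuous (fun t => f (t + h)).
Proof.
move=> uf x a /uf /nbhs_ballP[e /= e0 be]; apply/nbhs_ballP; exists e => //=.
move=> y xy; apply: be; move: xy; rewrite /ball /=.
by rewrite (_ : x + h - (y + h) = x - y)//; ring.
Qed.

Lemma argloc_ge f T h : upper_semicontinuous f -> 0 <= T -> h <= argloc T f h.
Proof.
move=> /(usc_shift (h := h)) uf T0; have [/andP[i0 _] _] := argsup_inf uf T0.
by rewrite lerDl.
Qed.

Lemma argloc_le f T h : upper_semicontinuous f -> 0 <= T ->
  argloc T f h <= h + T.
Proof.
move=> /(usc_shift (h := h)) uf T0; have [/andP[_ iT] _] := argsup_inf uf T0.
by rewrite lerD2l.
Qed.

Lemma argloc_max f T h s : upper_semicontinuous f ->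
  h <= s <= h + T -> f s <= f (argloc T f h).
Proof.
move=> /(usc_shift (h := h)) uf /andP[hs sT].
have T0 : 0 <= T by lra.
have [iT /(path_supP uf iT)] := argsup_inf uf T0.
move=> /(_ (s - h)) /=; rewrite /argloc subrK [h + _]addrC; apply.
by apply/andP; split; lra.
Qed.

Lemma argloc_leftmost f T h s : upper_semicontinuous f ->
  h <= s <= h + T -> f (argloc T f h) <= f s -> argloc T f h <= s.
Proof.
move=> uf sT fs; have [hs sT'] := andP sT.
have ufh := usc_shift (h := h) uf.
rewrite /argloc -lerBrDl; apply: ge_inf; first by exists 0 => x [/andP[]].
have sT0 : 0 <= s - h <= T by apply/andP; split; lra.
split => //; apply/path_supP => // x xT; rewrite subrK.
apply: le_trans fs; apply: argloc_max => //.
by move: xT => /andP[? ?]; apply/andP; split; lra.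
Qed.

(** Each location lies in both windows, so the two values agree, and the leftmost rule gives both
    inequalities. *)
Lemma argloc_eq f T h h' : upper_semicontinuous f -> h <= h' -> 0 <= T ->
  h' <= argloc T f h -> argloc T f h' <= h + T ->
  argloc T f h' = argloc T f h.
Proof.
move=> uf hh' T0 le1 le2.
have ge0 := argloc_le h uf T0; have ge1 := argloc_ge h' uf T0.
have w1 : h <= argloc T f h' <= h + T by apply/andP; split; lra.
have w2 : h' <= argloc T f h <= h' + T by apply/andP; split; lra.
apply/le_anti/andP; split.
  by apply: argloc_leftmost => //; exact: argloc_max.
by apply: argloc_leftmost => //; exact: argloc_max.
Qed.

(** The maximum over [[a, b]] is attained; if it were below [c], some rational level between the two
    would be missed. *)
Lemma hits_rat f a b c : upper_semicontinuous f -> a <= b ->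
  (forall q : rat, ratr q <= c -> hits a b (ratr q) f) -> hits a b c f.
Proof.
move=> uf ab hq; have [m mab mmax] := usc_max uf ab.
exists m => //; rewrite leNgt; apply/negP => /rat_in_itvoo[q].
rewrite in_itv/= => /andP[mq qc].
have [t tab qt] := hq q (ltW qc).
by have := lt_le_trans mq qt; rewrite ltNge mmax.
Qed.

Lemma hits_argloc f T h c : upper_semicontinuous f -> 0 <= T ->
  hits 0 T c (fun t => f (t + h)) <-> c <= f (argloc T f h).
Proof.
move=> uf T0; split => [[t /andP[t0 tT] ct]|cf].
  apply: le_trans ct _; apply: argloc_max => //.
  by apply/andP; split; lra.
have := argloc_le h uf T0; have := argloc_ge h uf T0.
exists (argloc T f h - h); last by rewrite subrK.
by apply/andP; split; lra.
Qed.

(** The supremum over [[0, T]] is already reached on [[0, t]]; comparing hits of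
    rational levels makes this a path event. *)
Definition low T t : set (R -> R) :=
  \bigcap_(q : rat) (~` hits 0 T (ratr q) `|` hits 0 t (ratr q)).

Lemma low_argloc f T h t : upper_semicontinuous f -> 0 <= t <= T ->
  low T t (fun s => f (s + h)) <-> argloc T f h <= h + t.
Proof.
move=> uf /andP[t0 tT]; have T0 : 0 <= T by lra.
have ufh := usc_shift (h := h) uf.
have := argloc_ge h uf T0; have := argloc_le h uf T0 => lT l0.
split=> [lo|lt q _].
  have [|s /andP[s0 st] fs] := @hits_rat _ 0 t (f (argloc T f h)) ufh t0.
    by move=> q /(hits_argloc _ _ uf T0) hq; case: (lo q I).
  apply: le_trans (argloc_leftmost uf _ fs) _.
    by apply/andP; split; lra.
  by lra.
have [|/negP nq] := boolP (ratr q <= f (argloc T f h)); last first.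
  by left => /(hits_argloc _ _ uf T0).
move=> qf; right; exists (argloc T f h - h); last by rewrite subrK.
by apply/andP; split; lra.
Qed.

(** The supremum over [[0, T]] is reached on both [[0, r]] and [[r', T]] for some
    rationals [r < r']. *)
Definition tied T : set (R -> R) :=
  \bigcup_(r : rat) \bigcup_(r' in [set r' : rat | r < r'])
    (low T (ratr r) `&`
     \bigcap_(q : rat) (~` hits 0 T (ratr q) `|` hits (ratr r') T (ratr q))).

(** Rationals [r < r'] separate two distinct maximizers; conversely, [hits_rat] recovers a maximizer
    in each of [[0, r]] and [[r', T]]. *)
Lemma tied_argsup f T : upper_semicontinuous f -> 0 <= T ->
  tied T f <-> exists t1 t2, [/\ t1 != t2, argsup T f t1 & argsup T f t2].
Proof.
move=> uf T0.
have [mT /(path_supP uf mT) mmax] := argsup_inf uf T0.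
set m := inf (argsup T f) in mT mmax.
have argE s : 0 <= s <= T -> f m <= f s -> argsup T f s.
  move=> sT fs; split => //; apply/(path_supP uf sT) => x /mmax.
  by move/le_trans; apply.
have mh q : q <= f m -> hits 0 T q f by exists m.
(* Hitting this one level shows that [[0, r]] and [[r', T]] are nonempty, as [hits_rat] requires. *)
have [q0] : exists q : rat, ratr q \in `](f m - 1), (f m)[.
  by apply: rat_in_itvoo; rewrite ltrBlDr ltrDl.
rewrite in_itv/= => /andP[_ /ltW q0m].
split=> [[r _ [r' /= rr' [lo hi]]]|[t1 [t2 []]]].
  have {}lo (q : rat) : ratr q <= f m -> hits 0 (ratr r) (ratr q) f.
    by move=> /mh; case: (lo q I).
  have {}hi (q : rat) : ratr q <= f m -> hits (ratr r') T (ratr q) f.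
    by move=> /mh; case: (hi q I).
  have r0 : 0 <= ratr r :> R.
    by have [t /andP[t0 tr] _] := lo _ q0m; apply: le_trans tr.
  have rT : ratr r' <= T.
    by have [t /andP[t0 tr] _] := hi _ q0m; apply: le_trans tr.
  have [t1 /andP[? ?] /argE a1] := hits_rat uf r0 lo.
  have [t2 /andP[? ?] /argE a2] := hits_rat uf rT hi.
  have : ratr r < ratr r' :> R by rewrite ltr_rat.
  move=> ?; exists t1, t2; split; first by rewrite lt_eqF//; lra.
    by apply: a1; lra.
  by apply: a2; lra.
wlog t12 : t1 t2 / t1 < t2.
  move=> W; have := W t1 t2; have := W t2 t1.
  case: (ltgtP t1 t2) => //= _; first by move=> _ /(_ isT); apply.
  by move=> /(_ isT isT) A _ _ a1 a2; apply: A.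
move=> _ [/andP[? ?] /path_supP - /(_ uf) m1].
move=> [/andP[? ?] /path_supP - /(_ uf) m2].
have [r] := rat_in_itvoo t12; rewrite in_itv/= => /andP[? rt2].
have [r'] := rat_in_itvoo rt2; rewrite in_itv/= => /andP[? ?].
exists r => //; exists r'; first by rewrite /= -(ltr_rat R).
split=> q _.
  have [|nq] := boolP (ratr q <= f m); last first.
    left => -[x xT qx]; move/negP: nq; apply; apply: le_trans qx _; exact: mmax.
  move=> qm; right; exists t1; first by apply/andP; split; lra.
  by apply: (le_trans qm); apply: m1 => //; apply/andP; split; lra.
have [|nq] := boolP (ratr q <= f m); last first.
  left => -[x xT qx]; move/negP: nq; apply; apply: le_trans qx _; exact: mmax.
move=> qm; right; exists t2; first by apply/andP; split; lra.
by apply: (le_trans qm); apply: m2 => //; apply/andP; split; lra.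
Qed.

Lemma tied_shift f T h s : upper_semicontinuous f ->
  h <= s <= h + T -> s != argloc T f h -> f s = f (argloc T f h) ->
  tied T (fun x => f (x + h)).
Proof.
move=> uf /andP[? ?] ns fs; have T0 : 0 <= T by lra.
have ufh := usc_shift (h := h) uf.
have := argloc_ge h uf T0; have := argloc_le h uf T0 => ? ?.
have fmax x : 0 <= x <= T -> f (x + h) <= f (argloc T f h).
  by move=> /andP[? ?]; apply: argloc_max => //; apply/andP; split; lra.
apply/(tied_argsup ufh T0); exists (s - h), (argloc T f h - h); split.
- by apply: contra ns => /eqP/addIr ->.
- have sT : 0 <= s - h <= T by apply/andP; split; lra.
  by split => //; apply/path_supP => // x; rewrite subrK fs; exact: fmax.
- have sT : 0 <= argloc T f h - h <= T by apply/andP; split; lra.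
  by split => //; apply/path_supP => // x; rewrite subrK; exact: fmax.
Qed.

End argloc.

(** * Real-valued calculus of probabilities *)

Section probability.
Context d (Omega : measurableType d) (R : realType) (P : probability Omega R).
Implicit Types A B : set Omega.

(** Real-valued, so that [lra] applies; [prK] goes back to [P]. *)
Definition pr A : R := fine (P A).

Lemma prK A : measurable A -> (pr A)%:E = P A.
Proof. by move=> mA; rewrite fineK// fin_num_measure. Qed.

Lemma pr_ge0 A : 0 <= pr A.
Proof. exact: fine_ge0. Qed.

Lemma pr_le A B : measurable A -> measurable B -> A `<=` B -> pr A <= pr B.
Proof.
by move=> mA mB AB; rewrite -lee_fin !prK//; apply: le_measure; rewrite ?inE.
Qed.

Lemma prT : pr setT = 1.
Proof. by rewrite /pr probability_setT. Qed.

Lemma pr_le1 A : measurable A -> pr A <= 1.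
Proof. by move=> mA; rewrite -prT; apply: pr_le. Qed.

Lemma prDI A B : measurable A -> measurable B ->
  pr A = pr (A `\` B) + pr (A `&` B).
Proof.
move=> mA mB; apply: EFin_inj; rewrite EFinD !prK//; last 2 first.
- exact: measurableI.
- exact: measurableD.
exact: measureDI.
Qed.

Lemma prU A B : measurable A -> measurable B -> A `&` B = set0 ->
  pr (A `|` B) = pr A + pr B.
Proof.
move=> mA mB AB; apply: EFin_inj; rewrite EFinD !prK//; last first.
  exact: measurableU.
exact: measureU.
Qed.

Lemma prU_le A B : measurable A -> measurable B ->
  pr (A `|` B) <= pr A + pr B.
Proof.
move=> mA mB; have mBA : measurable (B `\` A) by exact: measurableD.
have -> : A `|` B = A `|` (B `\` A).
  by rewrite eqEsubset; split => x /=; have [] := pselect (A x); tauto.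
rewrite prU//; last first.
  by rewrite -subset0 => x [? []].
by rewrite lerD2l pr_le// => x [].
Qed.

Lemma prD_sub A B : measurable A -> measurable B -> A `<=` B ->
  pr (B `\` A) = pr B - pr A.
Proof. by move=> mA mB AB; rewrite (prDI mB mA) (setIidr AB) addrK. Qed.

Lemma prD_eq A B : measurable A -> measurable B -> pr A = pr B ->
  pr (A `\` B) = pr (B `\` A).
Proof.
move=> mA mB; rewrite (prDI mA mB) (prDI mB mA) setIC => /eqP.
by rewrite (inj_eq (addIr _)) => /eqP.
Qed.

End probability.

(** * Measurability of events on the path space *)

Section path_events.
Context {R : realType}.
Implicit Types (T t h : R) (A : set (R -> R)).

(** Carrier of the sigma-algebra [path_event], to which the general measurability lemmas apply. *)
Definition path_space := g_sigma_algebraType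
  [set A : set (R -> R) | exists a b c : R, A = hits a b c].

Lemma measurable_hits_path a b c : measurable (hits a b c : set path_space).
Proof. by apply: sub_sigma_algebra; exists a, b, c. Qed.

Lemma bigcap_measurable_rat (F : rat -> set path_space) :
  (forall q, measurable (F q)) -> measurable (\bigcap_q F q).
Proof.
move=> mF; rewrite -[X in measurable X]setCK setC_bigcap.
by apply: measurableC; apply: bigcupT_measurable_rat => q; exact: measurableC.
Qed.

Lemma path_event_low T t : path_event (low T t).
Proof.
apply: bigcap_measurable_rat => q; apply: measurableU.
  by apply: measurableC; exact: measurable_hits_path.
exact: measurable_hits_path.
Qed.

Lemma path_event_hits a b c : path_event (hits a b c : set (R -> R)).
Proof. exact: measurable_hits_path. Qed.

Lemma path_eventI A B : path_event A -> path_event B -> path_event (A `&` B).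
Proof. exact: (@measurableI _ path_space). Qed.

Lemma path_event_tied T : path_event (tied T).
Proof.
apply: (@bigcupT_measurable_rat _ path_space) => r.
rewrite bigcup_mkcond; apply: bigcupT_measurable_rat => r'.
case: ifPn => // _; apply: measurableI; first exact: path_event_low.
apply: bigcap_measurable_rat => q; apply: measurableU.
  by apply: measurableC; exact: measurable_hits_path.
exact: measurable_hits_path.
Qed.

(** By minimality of the generated sigma-algebra: the shift pulls [hits a b c] back to
    [hits (a + h) (b + h) c]. *)
Lemma path_event_shift h A : path_event A ->
  path_event [set f | A (fun t => f (t + h))].
Proof.
move: A; apply: smallest_sub.
  split=> /= [|A|A].
  - exact: (@measurable0 _ path_space).
  - move=> mA; rewrite (_ : mkset _ = ~` [set f | A (fun t => f (t + h))]).
      exact: (@measurableC _ path_space).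
    by rewrite eqEsubset; split => f //= -[].
  - by move=> mA; exact: (@bigcupT_measurable _ path_space).
move=> _ [a [b [c ->]]] /=; apply: sub_sigma_algebra.
exists (a + h), (b + h), c; apply/seteqP; split => f /= [t tab ct].
  by exists (t + h) => //; rewrite !lerD2r.
by exists (t - h); rewrite ?subrK// lerBrDr lerBlDr.
Qed.

End path_events.

(** * Consequences of stationarity for cell probabilities *)

Section windows.
Context d (Omega : measurableType d) (R : realType) (P : probability Omega R).
Variables (X : usc_process Omega R) (T : R).
Hypotheses (hX : stationary P X) (T0 : 0 < T).

Local Notation L h w := (argloc T (X w) h).
Local Notation F := (tau_cdf P X T).

Definition below h t : set Omega := [set w | L h w <= h + t].

Lemma measurable_shift h A : path_event A ->
  measurable [set w | A (fun t => X w (t + h))].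
Proof. by move=> /(path_event_shift h) /(path_measurable X). Qed.

Lemma pr_shift h A : path_event A ->
  pr P [set w | A (fun t => X w (t + h))] = pr P [set w | A (X w)].
Proof. by move=> mA; rewrite /pr hX. Qed.

Lemma belowE h t : 0 <= t <= T ->
  below h t = [set w | low T t (fun s => X w (s + h))].
Proof.
move=> tT; apply/seteqP; split => w /=.
  by move/(low_argloc h (path_usc X w) tT).
by move/(low_argloc h (path_usc X w) tT).
Qed.

Lemma measurable_below h t : 0 <= t <= T -> measurable (below h t).
Proof.
by move=> tT; rewrite belowE//; apply: measurable_shift; exact: path_event_low.
Qed.

(** The event is the shift by [h] of the path event [low T t], so stationarity removes [h]. *)
Lemma pr_below h t : 0 <= t <= T -> pr P (below h t) = F t.
Proof.
move=> tT; rewrite belowE// (pr_shift h (path_event_low T t)).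
rewrite /tau_cdf /cdf /distribution /pushforward; congr (fine (P _)).
apply/seteqP; split => w /=; rewrite in_itv/=.
- have /= := low_argloc 0 (path_usc X w) tT.
  rewrite /argloc !add0r; under eq_fun do rewrite addr0.
  by case.
- have /= := low_argloc 0 (path_usc X w) tT.
  rewrite /argloc !add0r; under eq_fun do rewrite addr0.
  by case.
Qed.

Lemma below_sub h x y : x <= y -> below h x `<=` below h y.
Proof.
move=> xy w; rewrite /below /= => Lx; apply: le_trans Lx _.
by rewrite lerD2l.
Qed.

Definition cell h x y : set Omega := below h y `\` below h x.

Lemma measurable_cell h x y : 0 <= x -> x <= y -> y <= T ->
  measurable (cell h x y).
Proof.
by move=> x0 xy yT; apply: measurableD; apply: measurable_below; lra.
Qed.

Lemma pr_cell h x y : 0 <= x -> x <= y -> y <= T ->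
  pr P (cell h x y) = F y - F x.
Proof.
move=> x0 xy yT; have xT : 0 <= x <= T by lra.
have yT' : 0 <= y <= T by lra.
rewrite prD_sub ?pr_below//; try exact: measurable_below.
exact: below_sub.
Qed.

Lemma cellP h x y w : cell h x y w <-> h + x < L h w /\ L h w <= h + y.
Proof.
rewrite /cell /below /=; split => [[-> /negP]|[xL ->]]; first by rewrite -ltNge.
by split => //; apply/negP; rewrite -ltNge.
Qed.

(** The windows starting at [0, e, ..., n * e] give [n + 1] events of the same probability
    [F (t + e) - F t]. They are disjoint: if two of them held, both locations would lie in both
    windows and coincide, although they belong to different cells of the line. *)
Lemma tau_cdf_bound e t : 0 < e -> 0 <= t -> t + e <= T ->
  (F (t + e) - F t) * Num.min t (T - t - e) <= e.
Proof.
move=> e0 t0 teT.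
pose A (k : nat) := cell (k%:R * e) t (t + e).
have mA k : measurable (A k) by apply: measurable_cell => //; lra.
have pA k : pr P (A k) = F (t + e) - F t by rewrite pr_cell//; lra.
set mn := Num.min _ _.
have mn0 : 0 <= mn by rewrite le_min t0/=; lra.
have [mnt mnT] : mn <= t /\ mn <= T - t - e.
  by split; rewrite ge_min lexx ?orbT.
(* The largest number of shifts with [n * e <= mn]; this bound keeps each location inside all the
   windows compared. *)
set n := Num.truncn (mn / e).
have mne0 : 0 <= mn / e by rewrite divr_ge0// ltW.
have /andP[] := truncn_itv mne0; rewrite -/n => n1 n2.
have {}n1 : n%:R * e <= mn by rewrite -ler_pdivlMr.
have {}n2 : mn < n.+1%:R * e by rewrite -ltr_pdivrMr.
have disj j k : (j < k)%N -> (k <= n)%N -> A j `&` A k = set0.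
  move=> jk kn; rewrite -subset0 => w [/cellP[a1 a2] /cellP[b1 b2]].
  have jk1 : (j%:R + 1) * e <= k%:R * e.
    by rewrite ler_pM2r// natr1 ler_nat.
  have kn1 : k%:R * e <= n%:R * e by rewrite ler_pM2r// ler_nat.
  have j0 : 0 <= j%:R * e by rewrite mulr_ge0// ltW.
  have : L (k%:R * e) w = L (j%:R * e) w.
    apply: (argloc_eq (path_usc X w)); try lra.
  lra.
have sumA m : (m <= n.+1)%N ->
    measurable (\big[setU/set0]_(k < m) A k) /\
    pr P (\big[setU/set0]_(k < m) A k) = m%:R * (F (t + e) - F t).
  elim: m => [|m IH] mn1; first by rewrite big_ord0 /pr measure0/= mul0r.
  have [mU pU] := IH (ltnW mn1); rewrite big_ord_recr/=.
  split; first exact: measurableU.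
  rewrite prU// ?pU ?pA; first by rewrite -natr1; ring.
  rewrite -subset0 => w [+ Am]; rewrite -bigcup_mkord => -[k /= km Ak].
  by have := disj _ _ km mn1; rewrite -subset0; apply; split; [exact: Ak|].
have [mU pU] := sumA _ (leqnn _).
have := pr_le1 P mU; rewrite pU => le1.
have p0 : 0 <= F (t + e) - F t by rewrite -(pA 0%N) pr_ge0.
apply: (@le_trans _ _ ((F (t + e) - F t) * (n.+1%:R * e))).
  by apply: ler_wpM2l => //; exact: ltW.
rewrite mulrA [_ * n.+1%:R]mulrC; nra.
Qed.

(** Both events have probability [F t], so what each has outside the other has equal probability. *)
Lemma crossing_eq h h' t : 0 <= t <= T ->
  pr P (below h t `\` below h' t) = pr P (below h' t `\` below h t).
Proof.
by move=> tT; apply: prD_eq; rewrite ?pr_below//; exact: measurable_below.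
Qed.

(** On this event both locations lie in both windows, hence coincide; relative to [h + e] the common
    location is in [(t - e, t]]. *)
Lemma crossing_le h e t : 0 < e -> e <= t -> t + e <= T ->
  pr P (below (h + e) t `\` below h t) <= F t - F (t - e).
Proof.
move=> e0 et teT; rewrite -(@pr_cell (h + e)); [|lra..].
apply: pr_le; first by apply: measurableD; apply: measurable_below; lra.
  by apply: measurable_cell; lra.
move=> w /= [b1 /negP]; rewrite /below /= in b1 *; rewrite -ltNge => b2.
apply/cellP; split => //.
have -> : L (h + e) w = L h w; last by lra.
by apply: (argloc_eq (path_usc X w)); lra.
Qed.

(** The bound on the sum of positive parts announced in the overview. The hypothesis leaves one cell
    beyond cell [n], the room needed for a shift by [e]. *)
Lemma positive_increments e n
    (p := fun j : nat => F (j.+1%:R * e) - F (j%:R * e)) :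
  0 < e -> n.+2%:R * e <= T ->
  \sum_(0 <= j < n) Num.max (p j.+1 - p j) 0 <= p n.
Proof.
move=> e0 neT.
have jT j : (j <= n.+2)%N -> 0 <= j%:R * e <= T.
  move=> jn; apply/andP; split; first by apply: mulr_ge0 => //; exact: ltW.
  apply: le_trans neT.
  by rewrite ler_pM2r// ler_nat.
have TeT : 0 <= T - e <= T.
  by have := jT 1%N isT; rewrite mul1r => /andP[? ?]; apply/andP; split; lra.
(* On [K] the maximizer over [[e, e + T]] lies beyond [T]: a point entering at the right end has
   superseded the old one. *)
pose K := ~` below e (T - e).
have mK : measurable K by apply: measurableC; apply: measurable_below.
pose U j := below 0 (j%:R * e) `&` K.
have mU j : (j <= n.+2)%N -> measurable (U j).
  by move=> /jT jn; apply: measurableI => //; apply: measurable_below.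
have S j : j.+1%:R * e = j%:R * e + e by rewrite -natr1; ring.
have pj j : (j < n.+2)%N ->
    forall h, p j = pr P (cell h (j%:R * e) (j.+1%:R * e)).
  move=> jn h; rewrite pr_cell//.
  - by case/andP: (jT _ (ltnW jn)).
  - by rewrite S lerDl ltW.
  - by case/andP: (jT _ jn).
have mcell j h : (j < n.+2)%N -> measurable (cell h (j%:R * e) (j.+1%:R * e)).
  move=> jn; apply: measurable_cell.
  - by case/andP: (jT _ (ltnW jn)).
  - by rewrite S lerDl ltW.
  - by case/andP: (jT _ jn).
pose E j := cell 0 (j.+1%:R * e) (j.+2%:R * e) `&` K.
have mE j : (j < n)%N -> measurable (E j).
  by move=> jn; apply: measurableI => //; apply: mcell; rewrite ltnS ltnW.
(* Outside [K] a location in cell [j + 1] stays where it is, so it is in cell [j] relative to the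
   shifted window; that part has probability at most [p j]. *)
have incE j : (j < n)%N -> Num.max (p j.+1 - p j) 0 <= pr P (E j).
  move=> jn; rewrite ge_max pr_ge0 andbT lerBlDr.
  have j1 : (j.+1 < n.+2)%N := leqW jn.
  rewrite (pj _ j1 0) (pj _ (ltnW j1) e).
  have mc := mcell j.+1 0 j1.
  rewrite (prDI P mc (measurableC mK)) setDE setCK lerD2l.
 
  apply: pr_le; [by apply: measurableI => //; exact: measurableC| |].
    by apply: mcell; rewrite ltnS ltnW.
  rewrite setCK => w [/cellP[c1 c2] Kw]; apply/cellP.
  have /andP[_ ?] := jT _ j1.
  have /andP[? _] := jT _ (leq_trans (leqW (leqnSn _)) j1 : j <= n.+2)%N.
  rewrite /below /= in Kw; rewrite !S in c1 c2 *.
  have : L e w = L 0 w by apply: (argloc_eq (path_usc X w)); lra.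
  lra.
(* [U m.+1] and [E m] are disjoint, and their union is inside [U m.+2]. *)
have sumU m : (m <= n)%N ->
    \sum_(0 <= j < m) Num.max (p j.+1 - p j) 0 <= pr P (U m.+1).
  elim: m => [_|m IH mn]; first by rewrite big_geq// pr_ge0.
  rewrite big_nat_recr//=; apply: le_trans (lerD (IH (ltnW mn)) (incE _ mn)) _.
  rewrite -prU; [| |exact: mE|].
  - apply: pr_le; [apply: measurableU; [|exact: mE]| |].
    + by apply: mU; rewrite ltnS ltnW// ltnW.
    + by apply: mU; rewrite ltnS ltnW.
    + move=> w [[b Kw]|[[b _] Kw]]; split => //.
      by apply: below_sub b; rewrite (S m.+1) lerDl ltW.
  - by apply: mU; rewrite ltnS ltnW// ltnW.
  - by rewrite -subset0 => w [[b _] [[_ b'] _]].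
apply: le_trans (sumU _ (leqnn _)) _.
have nT : 0 <= n.+1%:R * e <= T by apply: jT; exact: leqnSn.
have neT' : n.+1%:R * e + e <= T by rewrite -S.
have en : e <= n.+1%:R * e.
  by rewrite -[leLHS]mul1r ler_pM2r// ler1n.
have -> : p n = F (n.+1%:R * e) - F (n.+1%:R * e - e) by rewrite S addrK -S.
(* On [U n.+1] the relative location moves from at most [n.+1 * e] to above it. Such moves are as
   likely as the opposite ones, which [crossing_le] confines to cell [n]. *)
apply: le_trans (crossing_le 0 e0 en neT'); rewrite -crossing_eq// add0r.
apply: pr_le; [exact: mU| |].
  by apply: measurableD; exact: measurable_below.
move=> w [b Kw]; split => // b'; apply: Kw; apply: below_sub b'; lra.
Qed.

End windows.

(** * Runs of windows whose maximizers stay on one side of a level *)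

Section monotone_runs.
Context {R : realType}.
Implicit Types (f : R -> R) (T t e : R) (n : nat).

(** Each new maximizer already lies in the previous window, so the maxima do not increase. If the
    last equals the first, all are equal, and without ties the location never moves. *)
Lemma low_run f T t e n : upper_semicontinuous f -> 0 < e -> 0 <= t ->
  t + e <= T ->
  (forall k, (k <= n)%N -> argloc T f (k%:R * e) <= k%:R * e + t) ->
  f (argloc T f (n%:R * e)) <= f (argloc T f 0) /\
  ((forall k, (k < n)%N -> ~ tied T (fun s => f (s + k%:R * e))) ->
   f (argloc T f (n%:R * e)) = f (argloc T f 0) ->
   argloc T f (n%:R * e) = argloc T f 0).
Proof.
move=> uf e0 t0 teT; elim: n => [|n IH] lown; first by rewrite mul0r.
have [k kn|IH1 IH2] := IH; first by apply: lown; rewrite leqW.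
set L := argloc T f (n%:R * e) in IH1 IH2.
have := lown n.+1 (leqnn _); rewrite -natr1 mulrDl mul1r.
set L' := argloc T f (n%:R * e + e) => L't.
have L'w : n%:R * e <= L' <= n%:R * e + T.
  have : n%:R * e + e <= L' by apply: argloc_ge => //; lra.
  by move=> ?; lra.
have fL' : f L' <= f L by exact: argloc_max.
split=> [|nt eqf]; first exact: le_trans IH1.
have fL'L : f L' = f L.
  by apply/le_anti; rewrite fL'/= eqf.
rewrite -IH2 -?fL'L//; last by move=> k kn; apply: nt; rewrite leqW.
apply: contrapT => /eqP L'L; apply: (nt n) => //.
exact: tied_shift fL'L.
Qed.

(** Each old maximizer is still in the next window, so the maxima do not decrease. Ties are harmless
    here: at equal values the leftmost rule puts the new location to the left of the old one, hence
    in both windows. *)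
Lemma high_run f T t e n : upper_semicontinuous f -> 0 < e -> e <= t ->
  0 <= T ->
  (forall k, (k <= n)%N -> k%:R * e + t < argloc T f (k%:R * e)) ->
  f (argloc T f 0) <= f (argloc T f (n%:R * e)) /\
  (f (argloc T f (n%:R * e)) = f (argloc T f 0) ->
   argloc T f (n%:R * e) = argloc T f 0).
Proof.
move=> uf e0 et T0; elim: n => [|n IH] highn; first by rewrite mul0r.
have [k kn|IH1 IH2] := IH; first by apply: highn; rewrite leqW.
have := highn n (leqnSn _); rewrite -natr1 mulrDl mul1r.
set L := argloc T f (n%:R * e) in IH1 IH2 *.
set L' := argloc T f (n%:R * e + e) => Lt.
have LT : L <= n%:R * e + T by exact: argloc_le.
have Lw : n%:R * e + e <= L <= n%:R * e + e + T by lra.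
have fL' : f L <= f L' by exact: argloc_max.
split=> [|eqf]; first exact: le_trans fL'.
have fLL' : f L' = f L.
  by apply/le_anti; rewrite fL' andbT eqf.
rewrite -IH2 -?fLL'//.
have hh : n%:R * e <= n%:R * e + e by lra.
have eL : n%:R * e + e <= L by lra.
apply: (argloc_eq uf hh T0 eL).
by apply: le_trans LT; apply: argloc_leftmost; rewrite // fLL'.
Qed.

End monotone_runs.

(** * Positive lower bound in the absence of ties *)

Section lower_bound.
Context d (Omega : measurableType d) (R : realType) (P : probability Omega R).
Variables (X : usc_process Omega R) (T : R).
Hypotheses (hX : stationary P X) (T0 : 0 < T) (hU : assumption_U P X T).

Local Notation L h w := (argloc T (X w) h).
Local Notation F := (tau_cdf P X T).
Local Notation below := (below X T).

Lemma pr_tied h : P [set w | tied T (fun s => X w (s + h))] = 0%E.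
Proof.
rewrite hX; last exact: path_event_tied.
rewrite -hU; congr (P _); apply/seteqP; split => w /=.
  by move/(tied_argsup (path_usc X w) (ltW T0)).
by move/(tied_argsup (path_usc X w) (ltW T0)).
Qed.

Definition crossing (t e : R) (k : nat) :=
  (below (k%:R * e) t `\` below (k.+1%:R * e) t) `|`
  (below (k.+1%:R * e) t `\` below (k%:R * e) t).

Definition crossings (t e : R) n := \big[setU/set0]_(k < n) crossing t e k.

Lemma measurable_crossings t e n : 0 <= t <= T -> measurable (crossings t e n).
Proof.
move=> tT; apply: bigsetU_measurable => k _.
by apply: measurableU; apply: measurableD; exact: measurable_below.
Qed.

Lemma pr_crossings t e n : 0 < e -> e <= t -> t + e <= T ->
  pr P (crossings t e n) <= n%:R * (2 * (F t - F (t - e))).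
Proof.
move=> e0 et teT; have tT : 0 <= t <= T by lra.
elim: n => [|n IH]; first by rewrite /crossings big_ord0 /pr measure0 mul0r.
rewrite /crossings big_ord_recr/= -/(crossings t e n).
rewrite -[in leRHS]natr1 [leRHS]mulrDl.
have mD h h' : measurable (below h t `\` below h' t).
  by apply: measurableD; exact: measurable_below.
apply: le_trans (prU_le P (measurable_crossings _ _ tT) _) _.
  exact: measurableU.
apply: lerD => //; apply: le_trans (prU_le P (mD _ _) (mD _ _)) _.
rewrite (crossing_eq hX _ _ tT).
have -> : n.+1%:R * e = n%:R * e + e by rewrite -natr1; ring.
by have := crossing_le hX (n%:R * e) e0 et teT; lra.
Qed.

Lemma no_crossing t e n w : ~ crossings t e n w ->
  forall k, (k <= n)%N -> below (k%:R * e) t w <-> below 0 t w.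
Proof.
rewrite /crossings -bigcup_mkord => nc.
elim=> [|k IH] kn; first by rewrite mul0r.
rewrite -(IH (ltnW kn)).
have {}nc : ~ crossing t e k w.
  by move=> C; apply: nc; exists k.
split=> b; apply: contrapT => nb; apply: nc; [by right|by left].
Qed.

Definition above (h c : R) := [set w | hits 0 T c (fun s => X w (s + h))].

Lemma measurable_above h c : measurable (above h c).
Proof. by apply: measurable_shift; exact: path_event_hits. Qed.

Lemma aboveP h c w : above h c w <-> c <= X w (L h w).
Proof. by apply: hits_argloc; [exact: path_usc|exact: ltW]. Qed.

(** The maximum of a window and the side of [t] where it is located are read off shifted path
    events, so their joint law does not depend on [h]. *)
Lemma pr_above h c t : 0 <= t <= T ->
  pr P (above h c `&` below h t) = pr P (above 0 c `&` below 0 t).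
Proof.
move=> tT; have E h' : above h' c `&` below h' t =
    [set w | (hits 0 T c `&` low T t) (fun s => X w (s + h'))].
  by rewrite belowE.
have m : path_event (hits 0 T c `&` low T t).
  by apply: path_eventI; [exact: path_event_hits|exact: path_event_low].
by rewrite !E !(pr_shift hX _ m).
Qed.

Lemma pr_above_high h c t : 0 <= t <= T ->
  pr P (above h c `\` below h t) = pr P (above 0 c `\` below 0 t).
Proof.
move=> tT; have := prDI P (measurable_above h c) (measurable_below X h tT).
have := prDI P (measurable_above 0 c) (measurable_below X 0 tT).
rewrite pr_above//; have -> : pr P (above h c) = pr P (above 0 c).
  by rewrite !(pr_shift hX _ (path_event_hits _ _ _)).
by move=> -> /eqP; rewrite (inj_eq (addIr _)) => /eqP ->.
Qed.

Section run.
Variables (t e : R) (n : nat).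
Hypotheses (e0 : 0 < e) (et : e <= t) (teT : t + e <= T) (neT : n%:R * e = T).

Let tT : 0 <= t <= T.
Proof. by move: e0 et teT; lra. Qed.

Let low_run_max w : ~ crossings t e n w -> below 0 t w ->
  X w (L T w) <= X w (L 0 w) /\
  ((forall k : nat, ~ tied T (fun s => X w (s + k%:R * e))) ->
   X w (L T w) != X w (L 0 w)).
Proof.
move=> nc b.
have t0 : 0 <= t := le_trans (ltW e0) et.
have [|le1 ne1] := low_run (n := n) (path_usc X w) e0 t0 teT.
  by move=> k kn; apply: ((no_crossing nc kn).2 b).
(* Equal locations are impossible, since [L 0 w <= t < T <= L T w]. *)
rewrite neT in le1 ne1; split=> // nt; apply/eqP => /(ne1 (fun k _ => nt k)).
have := argloc_ge T (path_usc X w) (ltW T0).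
by rewrite /below /= in b; move: e0 teT; lra.
Qed.

Let high_run_max w : ~ crossings t e n w -> ~ below 0 t w ->
  X w (L 0 w) <= X w (L T w) /\ X w (L T w) != X w (L 0 w).
Proof.
move=> nc b.
have above_k k : (k <= n)%N -> k%:R * e + t < L (k%:R * e) w.
  move=> kn; rewrite ltNge; apply/negP => bk; apply: b.
  exact: (no_crossing nc kn).1.
have [le1 ne1] := high_run (path_usc X w) e0 et (ltW T0) above_k.
rewrite neT in le1 ne1; split=> //; apply/eqP => /ne1.
have := above_k n (leqnn n); rewrite neT.
by have := argloc_le 0 (path_usc X w) (ltW T0); move: e0 et; lra.
Qed.

(** Off the crossings, the maximum can only drop on the low side and only rise on the high side, so
    [A T] outside [A 0] and [B 0] outside [B T] lie in the crossings. *)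
Lemma pr_max_change c :
  pr P ((above 0 c `\` above T c) `|` (above T c `\` above 0 c)) <=
  4 * pr P (crossings t e n).
Proof.
pose A h := above h c `&` below h t; pose B h := above h c `\` below h t.
have mA h : measurable (A h).
  by apply: measurableI; [exact: measurable_above|exact: measurable_below].
have mB h : measurable (B h).
  by apply: measurableD; [exact: measurable_above|exact: measurable_below].
have mG := measurable_crossings e n tT.
have mD C D : measurable C -> measurable D -> measurable (C `\` D : set Omega).
  exact: measurableD.
have AT w : ~ crossings t e n w -> below T t w <-> below 0 t w.
  by move=> nc; have := no_crossing nc (leqnn n); rewrite neT.
have A_le : pr P (A T `\` A 0) <= pr P (crossings t e n).
  apply: pr_le; [exact: mD|exact: mG|] => w [[aT bT] nA].
  apply: contrapT => nc; have b0 := (AT w nc).1 bT.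
  have [le1 _] := low_run_max nc b0; apply: nA; split => //.
  by move/aboveP : aT => aT; apply/aboveP; exact: le_trans le1.
have B_le : pr P (B 0 `\` B T) <= pr P (crossings t e n).
  apply: pr_le; [exact: mD|exact: mG|] => w [[aT bT] nA].
  apply: contrapT => nc; have [le1 _] := high_run_max nc bT.
  apply: nA; split; last by move/(AT w nc).
  by move/aboveP : aT => aT; apply/aboveP; exact: le_trans le1.
(* Stationarity transfers the two bounds to the opposite differences, which makes four terms in
   all. *)
have A_eq := prD_eq (mA 0) (mA T) (esym (pr_above _ _ tT)).
have B_eq := prD_eq (mB 0) (mB T) (esym (pr_above_high _ _ tT)).
apply: (@le_trans _ _ (pr P (((A 0 `\` A T) `|` (A T `\` A 0)) `|`
                            ((B 0 `\` B T) `|` (B T `\` B 0))))).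
  apply: pr_le.
  - by apply: measurableU; apply: mD; exact: measurable_above.
  - by apply: measurableU; apply: measurableU; exact: mD.
  - move=> w; rewrite /A /B /=.
    have := pselect (below 0 t w); have := pselect (below T t w); tauto.
have mU C D : measurable C -> measurable D -> measurable (C `|` D : set Omega).
  exact: measurableU.
apply: le_trans (prU_le P _ _) _; [by apply: mU; exact: mD..|].
apply: le_trans (lerD (prU_le P (mD _ _ (mA 0) (mA T)) (mD _ _ (mA T) (mA 0)))
  (prU_le P (mD _ _ (mB 0) (mB T)) (mD _ _ (mB T) (mB 0)))) _.
lra.
Qed.

(** The assumption makes the maxima over [[0, T]] and [[T, 2 T]] almost surely equal, whereas
    without crossings and ties they differ. *)
Lemma one_le_crossings : (forall q : rat,
    pr P ((above 0 (ratr q) `\` above T (ratr q)) `|`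
          (above T (ratr q) `\` above 0 (ratr q))) = 0) ->
  1 <= pr P (crossings t e n).
Proof.
move=> noq.
have mC q : measurable ((above 0 q `\` above T q) `|` (above T q `\` above 0 q)).
  by apply: measurableU; apply: measurableD; exact: measurable_above.
have mt k : measurable [set w | tied T (fun s => X w (s + k%:R * e))].
  by apply: measurable_shift; exact: path_event_tied.
pose C (q : rat) := (above 0 (ratr q) `\` above T (ratr q)) `|`
     (above T (ratr q) `\` above 0 (ratr q)).
(* The rationals are enumerated through [unpickle]; integers that encode nothing give the level [0],
   whose event is null as well. *)
have N1 : P.-negligible (\bigcup_(k : nat) C (odflt 0 (unpickle k))).
  apply: negligible_bigcup => k; apply/negligibleP; first exact: mC.
  by have := prK P (mC (ratr (odflt 0 (unpickle k)))); rewrite noq => /esym.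
have N2 : P.-negligible (\bigcup_(k : nat)
    [set w | tied T (fun s => X w (s + k%:R * e))]).
  apply: negligible_bigcup => k; apply/negligibleP => //; exact: pr_tied.
have [N [mN PN sN]] := negligibleU N1 N2.
have mG := measurable_crossings e n tT.
rewrite -(prT P); apply: (@le_trans _ _ (pr P (crossings t e n `|` N))).
  apply: pr_le => //; first exact: measurableU.
  move=> w _; apply: contrapT => ncN.
  have nc : ~ crossings t e n w by move=> ?; apply: ncN; left.
  have nN : ~ N w by move=> ?; apply: ncN; right.
  have nt k : ~ tied T (fun s => X w (s + k%:R * e)).
    by move=> tk; apply/nN/sN; right; exists k.
  have neM : X w (L T w) != X w (L 0 w).
    have [b|b] := pselect (below 0 t w).
      by have [_ /(_ nt)] := low_run_max nc b.
    by have [] := high_run_max nc b.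
  apply/nN/sN; left.
  have [lt1|lt1|eq1] := ltgtP (X w (L T w)) (X w (L 0 w)).
  - have [q] := rat_in_itvoo lt1; rewrite in_itv/= => /andP[q1 q2].
    exists (pickle q) => //; rewrite pickleK; left.
    split; first by apply/aboveP; exact: ltW.
    by move/aboveP; rewrite leNgt q1.
  - have [q] := rat_in_itvoo lt1; rewrite in_itv/= => /andP[q1 q2].
    exists (pickle q) => //; rewrite pickleK; right.
    split; first by apply/aboveP; exact: ltW.
    by move/aboveP; rewrite leNgt q1.
  - by rewrite eq1 eqxx in neM.
apply: le_trans (prU_le P mG mN) _.
by rewrite [X in _ + X]/pr PN addr0.
Qed.

End run.

(** As [n * e = T], the quantity [n * (F t - F (t - e))] is [T] times a difference quotient of [F];
    it cannot be made arbitrarily small. *)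
Lemma no_small_cell : ~ forall g : R, 0 < g -> exists t e n,
  [/\ 0 < e, e <= t, t + e <= T, n%:R * e = T & n%:R * (F t - F (t - e)) <= g].
Proof.
move=> small.
have noq c : pr P ((above 0 c `\` above T c) `|` (above T c `\` above 0 c)) = 0.
  apply/le_anti; rewrite pr_ge0 andbT.
  apply/ler_addgt0Pl => g g0; rewrite addr0.
  (* The factor 8 is the 4 of [pr_max_change] times the 2 of [pr_crossings]. *)
  have [|t [e [n [e0 et teT neT le1]]]] := small (g / 8); first lra.
  apply: le_trans (pr_max_change e0 et teT neT c) _.
  have := pr_crossings n e0 et teT; lra.
(* With [1 / 4] the crossings have probability at most [1 / 2], against [one_le_crossings]. *)
have [|t [e [n [e0 et teT neT le1]]]] := small (1 / 4); first lra.
have := one_le_crossings e0 et teT neT (fun q => noq (ratr q)).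
have := pr_crossings n e0 et teT; lra.
Qed.

End lower_bound.

(** * Discrete convexity *)

Section convex_sums.
Context {R : realType}.
Implicit Types (V : nat -> R).

(** Both block averages are compared with the pivot [V j]. *)
Lemma convex_partial_sums V i j k : (i <= j <= k)%N ->
  (forall l m, (l <= m <= k)%N -> V l <= V m) ->
  (k%:R - j%:R) * (\sum_(0 <= l < j) V l - \sum_(0 <= l < i) V l) <=
  (j%:R - i%:R) * (\sum_(0 <= l < k) V l - \sum_(0 <= l < j) V l).
Proof.
move=> /andP[ij jk] ndV.
have kj0 : 0 <= k%:R - j%:R :> R by rewrite subr_ge0 ler_nat.
have ji0 : 0 <= j%:R - i%:R :> R by rewrite subr_ge0 ler_nat.
have splitS a b : (a <= b)%N -> \sum_(0 <= l < b) V l - \sum_(0 <= l < a) V l =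
    \sum_(a <= l < b) V l.
  by move=> ab; rewrite (big_cat_nat _ ab)//= addrAC subrr add0r.
rewrite !splitS//.
have le1 : \sum_(i <= l < j) V l <= (j%:R - i%:R) * V j.
  rewrite -natrB// mulr_natl -sumr_const_nat.
  by apply: ler_sum_nat => l /andP[_ lj]; apply: ndV; rewrite (ltnW lj).
have le2 : (k%:R - j%:R) * V j <= \sum_(j <= l < k) V l.
  rewrite -natrB// mulr_natl -sumr_const_nat.
  by apply: ler_sum_nat => l /andP[jl lk]; apply: ndV; rewrite jl ltnW.
apply: le_trans (ler_wpM2l kj0 le1) _.
by rewrite mulrCA; exact: ler_wpM2l.
Qed.

End convex_sums.

(** * The distribution function as a convex plus a concave function *)

Section decomposition.
Context {R : realType}.
Implicit Types (x y z : R) (G : R -> R).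

(** The three-slope inequality, cross-multiplied so that coinciding points need no separate case. *)
Definition convex_on (T : R) G := forall x y z,
  0 < x -> x <= y -> y <= z -> z < T ->
  (z - y) * (G y - G x) <= (y - x) * (G z - G y).

Definition nondecreasing_on (T : R) G := forall x y,
  0 < x -> x <= y -> y < T -> G x <= G y.

(** A single filter along which every eventually bounded sequence converges: the limits at all
    points of the interval exist at once, without extracting subsequences. *)
Lemma ultrafilter_limits : exists2 U : set_system nat, ProperFilter U &
  \oo `<=` U /\ forall u : R^nat,
    (exists a b, \forall m \near \oo, a <= u m <= b) -> cvg (u @ U).
Proof.
have [U [ultraU ooU]] :=
  ultraFilterLemma (eventually_filter : ProperFilter \oo).
exists U; first exact: ultra_proper.
split=> // u [a [b uab]].
have ultra_u : UltraFilter (u @ U).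
  split; first exact: fmap_proper_filter.
  move=> G GF sG; rewrite predeqE => B; split; last exact: sG.
  move=> GB; have [//|UB] := in_ultra_setVsetC (u @^-1` B) ultraU.
  have /sG GnB : (u @ U) (~` B) by [].
  by have /filter_ex [? []] : G (B `&` ~` B) by exact: filterI.
have := @segment_compact R a b; rewrite compact_ultra.
move=> /(_ _ ultra_u) [].
  by apply: ooU; apply: filterS uab => m; rewrite /= in_itv.
by move=> l [_ lc]; apply/cvg_ex; exists l.
Qed.

Variables (F : R -> R) (T : R).
Hypotheses (T0 : 0 < T)
  (F_nd : forall x y, 0 <= x -> x <= y -> y <= T -> F x <= F y)
  (F_cont : forall x, 0 < x < T -> F y @[y --> x] --> F x)
  (F_incr : forall e n (p := fun j : nat => F (j.+1%:R * e) - F (j%:R * e)),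
    0 < e -> n.+2%:R * e <= T ->
    \sum_(0 <= j < n) Num.max (p j.+1 - p j) 0 <= p n).

(** The grid of mesh [e m]. [V m] is the nondecreasing part of [p m]: what remains, [p m - V m], is
    nonincreasing, and by [F_incr] nonnegative on the cells used. *)
Let e (m : nat) : R := T / m.+1%:R.
Let idx m x : nat := Num.truncn (x / e m).
Let p m (j : nat) := F (j.+1%:R * e m) - F (j%:R * e m).
Let V m j := \sum_(0 <= i < j) Num.max (p m i.+1 - p m i) 0.

Let e0 m : 0 < e m. Proof. by rewrite divr_gt0. Qed.

Let e_cvg : e m @[m --> \oo] --> 0.
Proof.
rewrite -[X in _ --> X](mulr0 T); apply: cvgM; first exact: cvg_cst.
exact: cvg_harmonic.
Qed.

Let idx_itv m x : 0 <= x -> (idx m x)%:R * e m <= x < (idx m x).+1%:R * e m.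
Proof.
move=> x0; have /truncn_itv : 0 <= x / e m by rewrite divr_ge0// ltW.
by rewrite ler_pdivlMr// ltr_pdivrMr.
Qed.

Let idx_cvg x : 0 <= x -> (idx m x)%:R * e m @[m --> \oo] --> x.
Proof.
move=> x0; apply: (squeeze_cvgr (f := fun m => x - e m) (h := fun=> x)).
- apply: nearW => m; have /andP[-> ] := idx_itv m x0.
  by rewrite -natr1 mulrDl mul1r andbT => ?; lra.
- by rewrite -[X in _ --> X]subr0; apply: cvgB => //; exact: cvg_cst.
- exact: cvg_cst.
Qed.

(** [F_incr] at [n = idx m x] asks for these two extra cells; they fit once [e m < (T - x) / 2]. *)
Let idx_near x : 0 < x < T -> \forall m \near \oo, (idx m x).+2%:R * e m <= T.
Proof.
move=> /andP[x0 xT]; have : 0 < (T - x) / 2 by lra.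
move=> /(cvgr_lt _ e_cvg); apply: filterS => m em.
have /andP[+ _] := idx_itv m (ltW x0); rewrite -2!natr1; lra.
Qed.

Let V_nd m i j : (i <= j)%N -> V m i <= V m j.
Proof.
move=> ij; rewrite /V (big_cat_nat _ ij)//= lerDl.
by apply: sumr_ge0 => k _; rewrite le_max lexx orbT.
Qed.

Let W_ni m i j : (i <= j)%N -> p m j - V m j <= p m i - V m i.
Proof.
elim: j => [|j IH]; first by rewrite leqn0 => /eqP ->.
rewrite leq_eqVlt => /predU1P[->//|/IH]; apply: le_trans.
rewrite /V big_nat_recr//= opprD addrA.
have : p m j.+1 - p m j <= Num.max (p m j.+1 - p m j) 0.
  by rewrite le_max lexx.
lra.
Qed.

(** Discrete counterparts of [G] and [H]; their sum telescopes in [GH_sum]. *)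
Let G_ m x := \sum_(0 <= j < idx m x) V m j.
Let H_ m x := \sum_(0 <= j < idx m x) (p m j - V m j).

Let W_ge0 m x j : (idx m x).+2%:R * e m <= T -> (j <= idx m x)%N ->
  0 <= p m j - V m j.
Proof.
move=> mT jx; rewrite subr_ge0; apply: F_incr => //.
by apply: le_trans mT; rewrite ler_pM2r// ler_nat !ltnS.
Qed.

Let GH_sum m x : G_ m x + H_ m x = F ((idx m x)%:R * e m) - F 0.
Proof.
rewrite -big_split/= (eq_bigr (fun j => p m j)); last by move=> j _; ring.
by rewrite (telescope_sumr (fun j => F (j%:R * e m)))// mul0r.
Qed.

Let V_ge0 m j : 0 <= V m j.
Proof. by apply: sumr_ge0 => k _; rewrite le_max lexx orbT. Qed.

Let sum_nd (c : nat -> nat -> R) m x y : 0 <= x -> x <= y ->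
  (forall j, (j <= idx m y)%N -> 0 <= c m j) ->
  \sum_(0 <= j < idx m x) c m j <= \sum_(0 <= j < idx m y) c m j.
Proof.
move=> x0 xy c0; have ixy : (idx m x <= idx m y)%N.
  by apply: le_truncn; rewrite ler_pM2r// invr_gt0.
rewrite [leRHS](big_cat_nat _ ixy)//= lerDl big_nat_cond sumr_ge0// => j.
by move=> /andP[/andP[_ jy] _]; apply: c0; exact: ltnW.
Qed.

Let bounded m x : 0 <= x -> (idx m x).+2%:R * e m <= T ->
  (0 <= G_ m x <= F T - F 0) /\ (0 <= H_ m x <= F T - F 0).
Proof.
move=> x0 mT.
have G0 : 0 <= G_ m x by apply: sumr_ge0 => j _; exact: V_ge0.
have H0 : 0 <= H_ m x.
  rewrite /H_ big_nat_cond; apply: sumr_ge0 => j /andP[/andP[_ jx] _].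
  by apply: W_ge0 mT _; exact: ltnW.
have := GH_sum m x.
have : F ((idx m x)%:R * e m) <= F T.
  apply: F_nd => //; first by rewrite mulr_ge0// ltW.
  by apply: le_trans mT; rewrite ler_pM2r// ler_nat -addn2 leq_addr.
by move=> *; split; lra.
Qed.

Lemma convex_concave_decomposition : exists G H : R -> R,
  [/\ forall x, 0 < x < T -> F x - F 0 = G x + H x,
      nondecreasing_on T G, nondecreasing_on T H,
      convex_on T G & convex_on T (fun x => - H x)].
Proof.
have [U PU [ooU cvgU]] := ultrafilter_limits.
have near (Q : set nat) : (\forall m \near \oo, Q m) -> \forall m \near U, Q m.
  exact: ooU.
have cG x : 0 < x < T -> cvg (G_ m x @[m --> U]).
  move=> xT; apply: cvgU; exists 0, (F T - F 0).
  apply: filterS (idx_near xT) => m /bounded[]//.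
  by case/andP: xT => /ltW.
have cH x : 0 < x < T -> cvg (H_ m x @[m --> U]).
  move=> xT; apply: cvgU; exists 0, (F T - F 0).
  apply: filterS (idx_near xT) => m /bounded[]//.
  by case/andP: xT => /ltW.
have cI x : 0 < x < T -> (idx m x)%:R * e m @[m --> U] --> x.
  by move=> /andP[/ltW x0 _] A /(idx_cvg x0); exact: ooU.
exists (fun x => lim (G_ m x @[m --> U])), (fun x => lim (H_ m x @[m --> U])).
(* Discrete convexity holds at the grid points just below [x], [y], [z]; these tend to [x], [y],
   [z], and the inequality passes to the limit. *)
have convex_lim (c : nat -> nat -> R) (g : R -> R) :
    (forall m i j k, (i <= j <= k)%N -> k.+2%:R * e m <= T -> c m i <= c m j) ->
    (forall x, 0 < x < T -> \sum_(0 <= j < idx m x) c m j @[m --> U] --> g x) ->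
    convex_on T g.
  move=> ndc cg x y z x0 xy yz zT.
  have xT' : 0 < x < T by lra.
  have yT' : 0 < y < T by lra.
  have zT' : 0 < z < T by lra.
  apply: (@ler_cvg_to _ U _ _ (fun m =>
    ((idx m z)%:R * e m - (idx m y)%:R * e m) *
    (\sum_(0 <= j < idx m y) c m j - \sum_(0 <= j < idx m x) c m j))
    (fun m => ((idx m y)%:R * e m - (idx m x)%:R * e m) *
    (\sum_(0 <= j < idx m z) c m j - \sum_(0 <= j < idx m y) c m j))).
  - by apply: cvgM; apply: cvgB; solve [exact: cI | exact: cg].
  - by apply: cvgM; apply: cvgB; solve [exact: cI | exact: cg].
  - apply: near; apply: filterS (idx_near zT') => m mT.
    (* Both sides carry the positive factor [e m], which cancels. *)
    rewrite -!mulrBl mulrAC [leRHS]mulrAC ler_pM2r//.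
    apply: convex_partial_sums.
      by apply/andP; split; apply: le_truncn; rewrite ler_pM2r// invr_gt0.
    by move=> l k lk; apply: ndc mT; exact: lk.
split.
- move=> x xT; have x0 : 0 <= x by case/andP: xT => /ltW.
  have c1 : F ((idx m x)%:R * e m) - F 0 @[m --> U] -->
      lim (G_ m x @[m --> U]) + lim (H_ m x @[m --> U]).
    under eq_fun do rewrite -GH_sum.
    by apply: cvgD; [exact: cG|exact: cH].
  have c2 : F ((idx m x)%:R * e m) - F 0 @[m --> U] --> F x - F 0.
    apply: cvgB; last exact: cvg_cst.
    by apply: (cvg_comp _ _ (cI x xT)); exact: F_cont.
  exact: (cvg_unique _ c2 c1).
- move=> x y x0 xy yT; apply: ler_lim; [apply: cG; lra|apply: cG; lra|].
  by apply: nearW => m; apply: sum_nd => //; exact: ltW.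
- move=> x y x0 xy yT; apply: ler_lim; [apply: cH; lra|apply: cH; lra|].
  have yT' : 0 < y < T by lra.
  apply: near; apply: filterS (idx_near yT') => m mT.
  apply: (sum_nd (c := fun m j => p m j - V m j)) => //; first exact: ltW.
  by move=> j; exact: W_ge0.
- apply: (convex_lim V) => [m i j k /andP[ij _] _|]; first exact: V_nd.
  by move=> x xT; exact: cG.
- apply: (convex_lim (fun m j => - (p m j - V m j))).
    by move=> m i j k /andP[ij _] _; rewrite lerN2; exact: W_ni.
  move=> x xT; under eq_fun do rewrite sumrN.
  by apply: cvgN; exact: cH.
Qed.

End decomposition.

(** * Right derivatives of convex functions *)

Section convex_derivative.
Context {R : realType}.
Variables (T : R) (G : R -> R).
Hypotheses (G_convex : convex_on T G)
  (G_cont : forall x, 0 < x < T -> G y @[y --> x] --> G x).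

Let quotient_nd t h h' : 0 < t -> 0 < h -> h <= h' -> t + h' < T ->
  right_quotient G t h <= right_quotient G t h'.
Proof.
move=> t0 h0 hh' hT; rewrite /right_quotient ler_pdivrMl//.
rewrite mulrCA ler_pdivlMl; last by lra.
have := @G_convex t (t + h) (t + h') t0.
move: (G t) (G (t + h)) (G (t + h')) => a b c.
move=> /(_ ltac:(lra) ltac:(lra) hT); lra.
Qed.

Let left_slope_le y t h : 0 < y -> y < t -> 0 < h -> t + h < T ->
  (G t - G y) / (t - y) <= right_quotient G t h.
Proof.
move=> y0 yt h0 hT; rewrite /right_quotient ler_pdivrMr; last lra.
rewrite mulrAC -mulrA ler_pdivlMl//.
have := @G_convex y t (t + h) y0.
move=> /(_ ltac:(lra) ltac:(lra) hT); lra.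
Qed.

(** The quotients decrease with [h] and are bounded below by the slope from [t / 2] to [t]. *)
Let quotient_cvg t : 0 < t < T -> right_quotient G t h @[h --> 0^'+] -->
  inf (right_quotient G t @` `]0, (T - t)[).
Proof.
move=> /andP[t0 tT].
apply: (@nondecreasing_at_right_cvgr _ _ 0 (BLeft (T - t))).
- by rewrite bnd_simp; lra.
- move=> h h'; rewrite !in_itv/= => /andP[? ?] /andP[? ?] ?.
  by apply: quotient_nd; lra.
- exists ((G t - G (t / 2)) / (t - t / 2)) => _ [h /= + <-].
  by rewrite in_itv/= => /andP[? ?]; apply: left_slope_le; lra.
Qed.

Lemma convex_right_derivable t : 0 < t < T ->
  right_quotient G t h @[h --> 0^'+] --> right_derivative G t.
Proof.
move=> tT; have := quotient_cvg tT; rewrite /right_derivative => c.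
by rewrite (cvg_lim _ c).
Qed.

Lemma convex_right_derivative_le t z : 0 < t -> t <= z -> z < T ->
  right_derivative G t * (z - t) <= G z - G t.
Proof.
move=> t0; rewrite le_eqVlt => /predU1P[->|tz] zT; first by rewrite !subrr mulr0.
have tT : 0 < t < T by rewrite t0 (lt_trans tz).
rewrite -ler_pdivlMr ?subr_gt0//.
have -> : (G z - G t) / (z - t) = right_quotient G t (z - t).
  by rewrite /right_quotient subrKC mulrC.
apply: (limr_le (convex_right_derivable tT)); near=> h.
have h0 : 0 < h by near: h; exact: nbhs_right_gt.
have hz : h <= z - t by near: h; apply: nbhs_right_le; rewrite subr_gt0.
by apply: quotient_nd; rewrite // subrKC.
Unshelve. all: by end_near. Qed.

Lemma convex_right_derivative_ge y t : 0 < y -> y <= t -> t < T ->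
  G t - G y <= right_derivative G t * (t - y).
Proof.
move=> y0; rewrite le_eqVlt => /predU1P[->|yt] tT; first by rewrite !subrr mulr0.
have tT' : 0 < t < T by rewrite tT (lt_trans y0).
rewrite -ler_pdivrMr ?subr_gt0//.
apply: (limr_ge (convex_right_derivable tT')); near=> h.
have h0 : 0 < h by near: h; exact: nbhs_right_gt.
have hT : h < T - t by near: h; apply: nbhs_right_lt; rewrite subr_gt0.
by apply: left_slope_le; rewrite // -ltrBrDl.
Unshelve. all: by end_near. Qed.

Lemma convex_right_derivative_nd : nondecreasing_on T (right_derivative G).
Proof.
move=> x y x0; rewrite le_eqVlt => /predU1P[->//|xy] yT.
have xy0 : 0 < y - x by lra.
rewrite -(ler_pM2r xy0); apply: le_trans (convex_right_derivative_ge x0 (ltW xy) yT).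
exact: convex_right_derivative_le (ltW xy) _.
Qed.

(** For [s > t] the derivative at [s] is at least the one at [t] and at most the slope from [s] to
    [t + h]. As [s] tends to [t] this slope tends to the quotient at [t], which is within [eps] of
    the derivative for small [h]. *)
Lemma convex_right_derivative_right_cont t : 0 < t < T ->
  right_derivative G s @[s --> t^'+] --> right_derivative G t.
Proof.
move=> tT; have /andP[t0 tT'] := tT.
apply/cvgrPdist_le => eps eps0.
have [h [h0 hT hle]] : exists h, [/\ 0 < h, t + h < T &
    right_quotient G t h < right_derivative G t + eps].
  near (0 : R)^'+ => h; exists h; split.
  - by near: h; exact: nbhs_right_gt.
  - by rewrite -ltrBrDl; near: h; apply: nbhs_right_lt; rewrite subr_gt0.
  - by near: h; apply: cvgr_lt (convex_right_derivable tT) _ _; rewrite ltrDl.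
have cq : (t + h - s)^-1 * (G (t + h) - G s) @[s --> t^'+] -->
    right_quotient G t h.
  have -> : right_quotient G t h = (t + h - t)^-1 * (G (t + h) - G t).
    by rewrite /right_quotient addrAC subrr add0r.
  apply: cvgM.
    apply: cvgV; first by rewrite addrAC subrr add0r gt_eqF.
    apply: cvg_at_right_filter.
    by apply: cvgB; [exact: cvg_cst|exact: cvg_id].
  apply: cvgB; first exact: cvg_cst.
  by apply: cvg_at_right_filter; exact: G_cont.
near=> s.
have ts : t < s by near: s; exact: nbhs_right_gt.
have sh : s < t + h by near: s; apply: nbhs_right_lt; rewrite ltrDl.
have sT : s < T by exact: lt_trans hT.
have le1 := convex_right_derivative_nd t0 (ltW ts) sT.
have le2 : right_derivative G s <= (t + h - s)^-1 * (G (t + h) - G s).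
  rewrite mulrC ler_pdivlMr ?subr_gt0//.
  by apply: convex_right_derivative_le => //; [exact: lt_trans ts|exact: ltW].
have : (t + h - s)^-1 * (G (t + h) - G s) < right_derivative G t + eps.
  by near: s; exact: cvgr_lt cq _ hle.
by rewrite distrC ger0_norm ?subr_ge0//; lra.
Unshelve. all: by end_near. Qed.

End convex_derivative.

(** * The density as a nondecreasing plus a nonincreasing function *)

Section density_split.
Context {R : realType}.
Variables (F : R -> R) (T : R).
Hypotheses (T0 : 0 < T)
  (F_nd : forall x y, 0 <= x -> x <= y -> y <= T -> F x <= F y)
  (F_cont : forall x, 0 < x < T -> F y @[y --> x] --> F x)
  (F_incr : forall e n (p := fun j : nat => F (j.+1%:R * e) - F (j%:R * e)),
    0 < e -> n.+2%:R * e <= T ->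
    \sum_(0 <= j < n) Num.max (p j.+1 - p j) 0 <= p n).

Lemma near_interval x : 0 < x < T -> \forall y \near x, 0 < y < T.
Proof.
move=> /andP[x0 xT]; near=> y; apply/andP; split; near: y.
  exact: lt_nbhsr.
exact: lt_nbhsl.
Unshelve. all: by end_near. Qed.

(** Since [H] is nondecreasing, the increments of [G] are dominated by those of the continuous
    [F]. *)
Lemma dominated_increments_cont (G H : R -> R) :
  (forall x, 0 < x < T -> F x - F 0 = G x + H x) ->
  nondecreasing_on T G -> nondecreasing_on T H ->
  forall x, 0 < x < T -> G y @[y --> x] --> G x.
Proof.
move=> FGH Gnd Hnd x xT; apply/cvgrPdist_le => eps eps0.
near=> y.
have yT : 0 < y < T by near: y; exact: near_interval.
have : `|F x - F y| <= eps.
  by near: y; move/cvgrPdist_le : (F_cont xT); apply.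
apply: le_trans.
have := FGH x xT; have := FGH y yT.
have [xy|/ltW yx] := leP x y.
  have le1 : G x <= G y by apply: Gnd => //; lra.
  have le2 : H x <= H y by apply: Hnd => //; lra.
  have le3 : F x <= F y by apply: F_nd => //; lra.
  by rewrite distrC ger0_norm ?subr_ge0// distrC ger0_norm ?subr_ge0//; lra.
have le1 : G y <= G x by apply: Gnd => //; lra.
have le2 : H y <= H x by apply: Hnd => //; lra.
have le3 : F y <= F x by apply: F_nd => //; lra.
by rewrite ger0_norm ?subr_ge0// ger0_norm ?subr_ge0//; lra.
Unshelve. all: by end_near. Qed.

Lemma density_split : exists A B : R -> R,
  [/\ forall t, 0 < t < T -> right_quotient F t h @[h --> 0^'+] --> A t + B t,
      forall t, 0 < t < T -> A s + B s @[s --> t^'+] --> A t + B t,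
      forall t, 0 < t < T -> 0 <= A t /\ 0 <= B t,
      nondecreasing_on T A /\ nondecreasing_on T (fun t => - B t) &
      forall x y, 0 < x -> x <= y -> y < T ->
        (A x + B y) * (y - x) <= F y - F x <= (A y + B x) * (y - x)].
Proof.
have [G [H [FGH Gnd Hnd Gc Hc]]] :=
  convex_concave_decomposition T0 F_nd F_cont F_incr.
have G_cont := dominated_increments_cont FGH Gnd Hnd.
have H_cont : forall x, 0 < x < T -> - H y @[y --> x] --> - H x.
  have FHG x : 0 < x < T -> F x - F 0 = H x + G x.
    by move=> /FGH ->; rewrite addrC.
  move=> x xT; apply: cvgN.
  exact: dominated_increments_cont FHG Hnd Gnd _ xT.
(* [H'] is the convex function [- H], not a derivative of [H]. *)
pose H' x := - H x; rewrite -/H' in Hc H_cont.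
exists (right_derivative G), (fun t => - right_derivative H' t); split.
- move=> t tT; have cG := convex_right_derivable Gc tT.
  have cH := convex_right_derivable Hc tT.
  have : right_quotient G t h - right_quotient H' t h @[h --> 0^'+] -->
      right_derivative G t - right_derivative H' t by exact: cvgB.
  apply: cvg_trans; apply: near_eq_cvg; near=> h.
  have h0 : 0 < h by near: h; exact: nbhs_right_gt.
  have hT : h < T - t.
    by near: h; apply: nbhs_right_lt; rewrite subr_gt0; case/andP: tT.
  have tT' := FGH t tT; have thT : 0 < t + h < T by lra.
  have := FGH _ thT; rewrite /right_quotient /H' -mulrBr => E.
  by congr (_ * _); lra.
- move=> t tT; apply: cvgD.
    exact: (convex_right_derivative_right_cont Gc G_cont tT).
  by apply: cvgN; exact: (convex_right_derivative_right_cont Hc H_cont tT).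
- move=> t tT; have [t0 tT'] := andP tT; split.
    have y0 : 0 < t / 2 by lra.
    have yt : t / 2 <= t by lra.
    have ty : 0 < t - t / 2 by lra.
    have := convex_right_derivative_ge Gc y0 yt tT'.
    have := Gnd _ _ y0 yt tT'.
    by rewrite -(pmulr_lge0 _ ty); lra.
  rewrite oppr_ge0; set z := t + (T - t) / 2.
  have tz : t <= z by rewrite /z; lra.
  have zT : z < T by rewrite /z; lra.
  have zt : 0 < z - t by rewrite /z; lra.
  have := convex_right_derivative_le Hc t0 tz zT.
  have := Hnd _ _ t0 tz zT.
  by rewrite -(pmulr_lle0 _ zt) /H'; lra.
- split; first exact: (convex_right_derivative_nd Gc).
  move=> x y x0 xy yT; rewrite !opprK; exact: (convex_right_derivative_nd Hc).
- move=> x y x0 xy yT.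
  have xT' : 0 < x < T by lra. have yT' : 0 < y < T by lra.
  have := FGH x xT'; have := FGH y yT'.
  have := convex_right_derivative_le Gc x0 xy yT.
  have := convex_right_derivative_ge Gc x0 xy yT.
  have := convex_right_derivative_le Hc x0 xy yT.
  have := convex_right_derivative_ge Hc x0 xy yT.
  rewrite /H' => *; apply/andP; split; nra.
Unshelve. all: by end_near. Qed.

End density_split.

(** * The law on the open interval as an integral of the density *)

Section density_measure.
Context {R : realType}.
Local Notation mu := lebesgue_measure.
Variables (D : set R) (f : R -> R).
Hypotheses (mD : measurable D) (mf : measurable_fun D f)
  (f0 : forall x, D x -> 0 <= f x).

(** The three proofs are arguments so that the measure structure can be inferred from the term. *)
Definition density_measure of measurable D & measurable_fun D f &
    (forall x, D x -> 0 <= f x) : set R -> \bar R :=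
  fun E => (\int[mu]_(x in E `&` D) (f x)%:E)%E.

Local Notation dens := (density_measure mD mf f0).

Let dens0 : dens set0 = 0%E.
Proof. by rewrite /density_measure set0I integral_set0. Qed.

Let dens_ge0 E : (0 <= dens E)%E.
Proof. by apply: integral_ge0 => x [_ Dx]; rewrite lee_fin f0. Qed.

Let dens_sigma_additive : semi_sigma_additive dens.
Proof.
move=> /= E mE tE mUE; rewrite /density_measure setI_bigcupl.
rewrite ge0_integral_bigcup.
- apply: is_cvg_ereal_nneg_natsum_cond => n _ _.
  by apply: integral_ge0 => x [_ Dx]; rewrite lee_fin f0.
- by move=> k; apply: measurableI; [exact: mE|exact: mD].
- apply/measurable_EFinP; apply: measurable_funS mf => //.
  by move=> x [k _ []].
- by move=> x [k _ [_ Dx]]; rewrite lee_fin f0.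
- by move=> i j _ _ [x [[Ei _] [Ej _]]]; apply: (tE i j) => //; exists x.
Qed.

HB.instance Definition _ := isMeasure.Build _ _ _
  dens dens0 dens_ge0 dens_sigma_additive.

End density_measure.

Section density.
Context {R : realType}.
Local Notation lambda := (@lebesgue_measure R).
Variables (T : R) (F A B f : R -> R).
Hypotheses (T0 : 0 < T) (A_nd : nondecreasing_on T A)
  (B_ni : nondecreasing_on T (fun t => - B t))
  (AB0 : forall t, 0 < t < T -> 0 <= A t /\ 0 <= B t)
  (fE : forall t, 0 < t < T -> f t = A t + B t)
  (F_incr : forall x y, 0 < x -> x <= y -> y < T ->
     (A x + B y) * (y - x) <= F y - F x <= (A y + B x) * (y - x))
  (mf : measurable_fun `]0, T[ f).

Let f_ge0 t : 0 < t < T -> 0 <= f t.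
Proof. by move=> tT; have [] := AB0 tT; rewrite fE//; lra. Qed.

Let I x y : \bar R := (\int[lambda]_(t in `]x, y]) (f t)%:E)%E.

Let sub_itv x y : 0 < x -> y < T -> `]x, y] `<=` `]0, T[.
Proof.
move=> x0 yT t; rewrite /= !in_itv/= => /andP[xt ty].
by rewrite (lt_trans x0)//= (le_lt_trans ty).
Qed.

Let mfitv x y : 0 < x -> y < T -> measurable_fun `]x, y] (EFin \o f).
Proof.
move=> x0 yT; apply/measurable_EFinP; apply: measurable_funS mf => //.
exact: sub_itv.
Qed.

Let cst_itv c x y : x <= y ->
  (\int[lambda]_(t in `]x, y]) (cst c%:E t) = (c * (y - x))%:E)%E.
Proof.
move=> xy.
have mK : measurable (`]x, y]%classic : set (measurableTypeR R)) by [].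
have := integral_cst lambda mK c%:E => /= ->.
have := @lebesgue_measure_itv R `]x, y] => /= ->; rewrite lte_fin.
move: xy; rewrite le_eqVlt => /predU1P[->|->]; last by rewrite -EFinB -EFinM.
by rewrite ltxx subrr mule0 mulr0.
Qed.

(** The same bounds as in [F_incr], which makes the integral comparable with the increment of
    [F]. *)
Let I_bounds x y : 0 < x -> x <= y -> y < T ->
  (((A x + B y) * (y - x))%:E <= I x y <= ((A y + B x) * (y - x))%:E)%E.
Proof.
move=> x0 xy yT; rewrite -!cst_itv//.
have bnd t : t \in `]x, y] -> A x + B y <= f t <= A y + B x.
  move=> txy; have := sub_itv x0 yT txy; rewrite /= !in_itv/= in txy * => tT.
  have /andP[xt ty] := txy.
  rewrite fE//.
  have := A_nd x0 (ltW xt) (le_lt_trans ty yT).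
  have := A_nd (lt_trans x0 xt) ty yT.
  have := B_ni x0 (ltW xt) (le_lt_trans ty yT).
  have := B_ni (lt_trans x0 xt) ty yT.
  lra.
have xT : 0 < x < T by lra.
have yT' : 0 < y < T by lra.
have [Ax Bx] := AB0 xT; have [Ay By] := AB0 yT'.
apply/andP; split; apply: ge0_le_integral => //=.
- by move=> t _; rewrite lee_fin; lra.
- exact: mfitv.
- by move=> t /bnd /andP[]; rewrite lee_fin.
- by move=> t /bnd /andP[? _]; rewrite lee_fin; lra.
- exact: mfitv.
- by move=> t /bnd /andP[_]; rewrite lee_fin.
Qed.

Let I_fin x y : 0 < x -> x <= y -> y < T -> I x y \is a fin_num.
Proof.
move=> x0 xy yT; have /andP[l1 l2] := I_bounds x0 xy yT.
by rewrite fin_numElt (lt_le_trans _ l1) ?ltNyr// (le_lt_trans l2)// ltry.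
Qed.

Let I_cat x z y : 0 < x -> x <= z -> z <= y -> y < T ->
  (I x y = I x z + I z y)%E.
Proof.
move=> x0 xz zy yT; rewrite /I -ge0_integral_setU//=.
- congr (integral _ _ _); apply/seteqP; split => t /=; rewrite !in_itv/=.
    by move=> /andP[-> ->]; rewrite andbT/=; case: leP; [left|right].
  by case=> /andP[h1 h2]; apply/andP; split; lra.
- rewrite (_ : _ `|` _ = `]x, y]%classic); first exact: mfitv.
  apply/seteqP; split => t /=; rewrite !in_itv/=; last first.
    by move=> /andP[-> ->]; rewrite andbT/=; case: leP; [left|right].
  by case=> /andP[h1 h2]; apply/andP; split; lra.
- move=> t; rewrite /= !in_itv/= lee_fin => xzy; apply: f_ge0.
  by case: xzy => /andP[h1 h2]; lra.
- apply/disj_setPS => t [] /=; rewrite !in_itv/= => /andP[_ tz] /andP[zt _].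
  by have := le_lt_trans tz zt; rewrite ltxx.
Qed.

(** On a subinterval [[x, y]] both sides are within [(D y - D x) (y - x)] of
    each other, where [D := A - B]; halving [n] times divides the error by
    [2 ^ n]. *)
Let I_error n x y : 0 < x -> x <= y -> y < T ->
  `|F y - F x - fine (I x y)| * 2 ^+ n <=
  ((A y - B y) - (A x - B x)) * (y - x).
Proof.
elim: n x y => [|n IH] x y x0 xy yT.
  rewrite expr0 mulr1.
  have /andP[l1 l2] := F_incr x0 xy yT.
  have := I_bounds x0 xy yT.
  rewrite -[I x y]fineK ?I_fin// !lee_fin => /andP[l3 l4].
  by rewrite ler_norml; apply/andP; split; nra.
have [z zE] : exists z, z = (x + y) / 2 by eexists.
have xz : x <= z by lra.
have zy : z <= y by lra.
have z0 : 0 < z by lra.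
have zT : z < T by lra.
have := IH _ _ x0 xz zT; have := IH _ _ z0 zy yT.
rewrite (I_cat x0 xz zy yT) (@fineD _ (I x z) (I z y)) ?I_fin//.
set i1 := fine (I x z); set i2 := fine (I z y).
move=> e1 e2; rewrite exprS.
have : `|F y - F x - (i1 + i2)| <= `|F y - F z - i2| + `|F z - F x - i1|.
  by apply: le_trans (ler_normD _ _); rewrite le_eqVlt; apply/orP; left;
    apply/eqP; congr (`| _ |); ring.
have n0 : 0 <= 2 ^+ n :> R by rewrite exprn_ge0.
move=> /(ler_wpM2r n0); rewrite mulrDl => tri.
have : (A y - B y - (A x - B x)) * (y - x) =
  2 * ((A y - B y - (A z - B z)) * (y - z) +
       (A z - B z - (A x - B x)) * (z - x)).
  have -> : y - z = (y - x) / 2 by rewrite zE; field.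
  have -> : z - x = (y - x) / 2 by rewrite zE; field.
  by field.
move=> ->; rewrite [2 * 2 ^+ n]mulrC mulrA [leRHS]mulrC ler_pM2r//.
exact: (le_trans tri (lerD e1 e2)).
Qed.

(** By [I_error] the error times [2 ^ n] is bounded independently of [n], so the error is zero. *)
Lemma integral_density x y : 0 < x -> x <= y -> y < T ->
  I x y = (F y - F x)%:E.
Proof.
move=> x0 xy yT; rewrite -[LHS]fineK ?I_fin//; congr (_%:E).
apply/eqP; rewrite eq_sym -subr_eq0 -normr_le0 leNgt; apply/negP => e0.
set e := `| _ | in e0; set C := ((A y - B y) - (A x - B x)) * (y - x).
have [n Cn] : exists n : nat, C < e * 2 ^+ n.
  exists (Num.bound `|C / e|); rewrite mulrC -ltr_pdivrMr//.
  apply: le_lt_trans (ler_norm _) _.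
  apply: lt_trans (archi_boundP (normr_ge0 _)) _.
  by rewrite -natrX ltr_nat ltn_expl.
by have := I_error n x0 xy yT; rewrite leNgt Cn.
Qed.

(** On []x, y]] with [0 < x] and [y < T], the two measures agree on half-open intervals, hence on
    all measurable sets; the open interval is then exhausted by such pieces. *)
Lemma law_density (nu : {finite_measure set R -> \bar R}) :
  (forall x y, 0 < x -> x <= y -> y < T ->
    nu `]x, y]%classic = (F y - F x)%:E) ->
  forall E : set R, measurable E -> E `<=` `]0, T[ ->
  nu E = (\int[lambda]_(t in E) (f t)%:E)%E.
Proof.
move=> nuF.
have onK x y : 0 < x -> x <= y -> y < T -> forall E, measurable E ->
    nu (E `&` `]x, y]%classic) = (\int[lambda]_(t in E `&` `]x, y]) (f t)%:E)%E.
  move=> x0 xy yT E mE.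
  have mK : measurable (`]x, y]%classic : set R) by [].
  have mfK : measurable_fun `]x, y] f.
    by apply: measurable_funS mf => //; exact: sub_itv.
  have fK0 t : `]x, y]%classic t -> 0 <= f t.
    by move=> /(sub_itv x0 yT); rewrite /= in_itv/=; exact: f_ge0.
  apply: (@measure_unique _ _ _ (@ocitv R) (fun k => `]- k%:R, k%:R]%classic)
    _ _ _ _ (mrestr nu mK) (density_measure mK mfK fK0)) => //.
  - exact: ocitvI.
  - by move=> k; exact: is_ocitv.
  - rewrite -subTset => t _; exists (Num.bound `|t|) => //=.
    have := archi_boundP (normr_ge0 t).
    by rewrite in_itv/= ltr_norml => /andP[-> /ltW ->].
  - move=> _ [[a b] _ <-] /=; rewrite /mrestr /density_measure.
    have -> : `]a, b]%classic `&` `]x, y]%classic =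
        `]Num.max a x, Num.min b y]%classic.
      apply/seteqP; split => t /=; rewrite !in_itv/= gt_max le_min.
        by move=> [/andP[-> ->] /andP[-> ->]].
      by move=> /andP[/andP[-> ->] /andP[-> ->]].
    have [lt1|le1] := ltP (Num.max a x) (Num.min b y); last first.
      by rewrite set_itv_ge ?measure0 ?integral_set0// bnd_simp -leNgt.
    have x1 : 0 < Num.max a x by rewrite lt_max x0 orbT.
    have y1 : Num.min b y < T by rewrite gt_min yT orbT.
    by rewrite (nuF _ _ x1 (ltW lt1) y1) -(integral_density x1 (ltW lt1) y1).
  - move=> k; rewrite /mrestr.
    by rewrite ltey_eq fin_num_measure//; exact: measurableI.
move=> E mE ET.
(* The offset 3 ensures [x n <= T - x n] from [n = 0] on. *)
pose x n : R := T / n.+3%:R.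
have x0 n : 0 < x n by rewrite divr_gt0.
have xT n : x n <= T - x n.
  rewrite lerBrDr -mulr2n -mulrnAl ler_pdivrMr// -mulr_natr ler_pM2l//.
  by rewrite ler_nat.
pose K n := E `&` `]x n, T - x n]%classic.
have mK n : measurable (K n) by exact: measurableI.
have EK : \bigcup_n K n = E.
  apply/seteqP; split => [t [n _ []]//|t Et].
  have := ET _ Et; rewrite /= in_itv/= => /andP[t0 tT].
  (* Both [T / t] and [T / (T - t)] are below [n + 3], so [t] is in []x n, T - x n]]. *)
  pose n := Num.bound `|T / t + T / (T - t)|.
  exists n => //; split=> //=; rewrite in_itv/=.
  have Tt : 0 < T / t by rewrite divr_gt0.
  have TTt : 0 < T / (T - t) by rewrite divr_gt0// subr_gt0.
  have bn : T / t + T / (T - t) < n.+3%:R.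
    apply: le_lt_trans (ler_norm _) _.
    apply: lt_le_trans (archi_boundP (normr_ge0 _)) _.
    by rewrite ler_nat -addn3 leq_addr.
  rewrite lerBrDl -lerBrDr; apply/andP; split.
    by rewrite ltr_pdivrMr// mulrC -ltr_pdivrMr//; lra.
  by rewrite ler_pdivrMr// mulrC -ler_pdivrMr ?subr_gt0//; lra.
have ndK : nondecreasing_seq K.
  move=> m n mn; apply/subsetPset => t [Et]; rewrite /= in_itv/= => /andP[h1 h2].
  split=> //=; rewrite in_itv/=.
  have : x n <= x m by rewrite ler_pM2l// lef_pV2 ?posrE// ler_nat !ltnS.
  by move=> ?; apply/andP; split; lra.
have mT : measurable (`]0, T[%classic : set R) by [].
have fT0 t : `]0, T[%classic t -> 0 <= f t by rewrite /= in_itv/=; exact: f_ge0.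
have mbig : measurable (\bigcup_n K n) by rewrite EK.
have c1 := nondecreasing_cvg_mu (mu := nu) mK mbig ndK.
have c2 := nondecreasing_cvg_mu (mu := density_measure mT mf fT0) mK mbig ndK.
rewrite EK /= in c1 c2.
have dE (D : set R) : D `<=` E ->
    density_measure mT mf fT0 D = (\int[lambda]_(t in D) (f t)%:E)%E.
  by move=> DE; rewrite /density_measure setIidl//; exact: subset_trans ET.
have nuK : nu \o K = density_measure mT mf fT0 \o K.
  apply/funext => n /=; rewrite dE => [|t []//].
  by rewrite onK//; rewrite ltrBlDr ltrDl.
by rewrite -dE//; rewrite nuK in c1; exact: (cvg_unique _ c1 c2).
Qed.

End density.

(** * Limits and variations of a sum of two monotone functions *)

(** [A] is bounded below and has a finite limit, [B] may tend to infinity; one finite term suffices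
    for the sum of the limits to be defined. *)
Lemma monotone_sum_right_cvg {R : realType} (a b : R) (A B : R -> R) : a < b ->
  {in `]a, b[ &, {homo A : x y / x <= y}} -> {in `]a, b[, forall x, 0 <= A x} ->
  {in `]a, b[ &, {homo B : x y /~ x <= y}} ->
  cvg ((A s + B s)%:E @[s --> a^'+]).
Proof.
move=> ab A_nd A0 B_ni.
have cA : cvg (A s @[s --> a^'+]).
  apply: nondecreasing_at_right_is_cvgr; near=> c.
    have cb : c < b by near: c; exact: nbhs_right_lt.
    move=> y z; rewrite !in_itv/= => ? ? ?.
    by apply: A_nd; rewrite ?in_itv/=; lra.
  have cb : c < b by near: c; exact: nbhs_right_lt.
  exists 0 => _ [y /= + <-]; rewrite in_itv/= => ?.
  by apply: A0; rewrite in_itv/=; lra.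
have cB : cvg ((B s)%:E @[s --> a^'+]).
  apply: nonincreasing_at_right_is_cvge; near=> c.
  have cb : c < b by near: c; exact: nbhs_right_lt.
  move=> y z; rewrite !in_itv/= => ? ? ?; rewrite lee_fin.
  by apply: B_ni; rewrite ?in_itv/=; lra.
apply/cvg_ex.
exists ((lim (A s @[s --> a^'+]))%:E + lim ((B s)%:E @[s --> a^'+]))%E.
rewrite (_ : (fun s => (A s + B s)%:E) = (fun s => (A s)%:E + (B s)%:E)%E)//.
apply: cvgeD; [exact: fin_num_adde_defr| |exact: cB].
apply: cvg_EFin; [exact: nearW|exact: cA].
Unshelve. all: by end_near. Qed.

Section monotone_sum.
Context {R : realType}.
Variables (T : R) (A B f : R -> R).
Hypotheses (T0 : 0 < T) (A_nd : nondecreasing_on T A)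
  (B_ni : nondecreasing_on T (fun t => - B t))
  (AB0 : forall t, 0 < t < T -> 0 <= A t /\ 0 <= B t)
  (fE : forall t, 0 < t < T -> f t = A t + B t).

Let m t := Num.min (f t) (left_limit f t).
Let f0 := lim ((f t)%:E @[t --> 0^'+]).
Let fT := lim ((f t)%:E @[t --> T^'-]).

Let A_le x y : 0 < x -> x <= y -> y < T -> A x <= A y.
Proof. exact: A_nd. Qed.

Let B_ge x y : 0 < x -> x <= y -> y < T -> B y <= B x.
Proof. by move=> x0 xy yT; rewrite -lerN2; exact: B_ni. Qed.

Let A_le_f t : 0 < t < T -> A t <= f t.
Proof. by move=> tT; rewrite fE// lerDl; have [] := AB0 tT. Qed.

Let B_le_f t : 0 < t < T -> B t <= f t.
Proof. by move=> tT; rewrite fE// lerDr; have [] := AB0 tT. Qed.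

Lemma monotone_sum_left_cvg t : 0 < t < T -> cvg (f s @[s --> t^'-]).
Proof.
move=> /andP[t0 tT].
have cvg_nd (C : R -> R) : nondecreasing_on T C -> cvg (C s @[s --> t^'-]).
  move=> C_nd; apply: nondecreasing_at_left_is_cvgr; near=> x.
    have x0 : 0 < x by near: x; exact: nbhs_left_gt.
    by move=> y z; rewrite !in_itv/= => ? ? ?; apply: C_nd; lra.
  have x0 : 0 < x by near: x; exact: nbhs_left_gt.
  exists (C t) => _ [y /= + <-]; rewrite in_itv/= => ?.
  by apply: C_nd; lra.
have cA := cvg_nd _ A_nd; have cB := cvg_nd _ B_ni.
have : cvg (A s - - B s @[s --> t^'-]) by exact: is_cvgB.
move=> /cvg_ex[l cl]; apply/cvg_ex; exists l.
apply: cvg_trans cl; apply: near_eq_cvg; near=> s.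
rewrite opprK fE//; apply/andP; split; last first.
  by apply: lt_trans tT; near: s; exact: nbhs_left_lt.
by near: s; exact: nbhs_left_gt.
Unshelve. all: by end_near. Qed.

Let le_m s u : 0 < u < T -> s <= f u ->
  (\forall v \near u^'-, s <= f v) -> s <= m u.
Proof.
move=> uT su near_u; rewrite le_min su/=.
by apply: limr_ge => //; exact: monotone_sum_left_cvg.
Qed.

(** [A s <= A v <= f v] for [v] between [s] and [u], and also at [u], so the bound holds for the
    value and for the left limit. *)
Let A_le_m s u : 0 < s -> s < u -> u < T -> A s <= m u.
Proof.
move=> s0 su uT; have u0 := lt_trans s0 su; apply: le_m; rewrite ?u0//.
  by apply: le_trans (A_le_f _); rewrite ?u0//; apply: A_le => //; exact: ltW.
near=> v; have sv : s < v by near: v; exact: nbhs_left_gt.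
have vT : v < T by apply: lt_trans uT; near: v; exact: nbhs_left_lt.
have vT' : 0 < v < T by rewrite vT (lt_trans s0 sv).
by apply: le_trans (A_le_f vT'); apply: A_le => //; exact: ltW.
Unshelve. all: by end_near. Qed.

Let B_le_m s u : 0 < u -> u < s -> s < T -> B s <= m u.
Proof.
move=> u0 us sT; have uT := lt_trans us sT; apply: le_m; rewrite ?u0//.
  by apply: le_trans (B_le_f _); rewrite ?u0//; apply: B_ge => //; exact: ltW.
near=> v; have v0 : 0 < v by near: v; exact: nbhs_left_gt.
have vu : v < u by near: v; exact: nbhs_left_lt.
have vT' : 0 < v < T by rewrite v0 (lt_trans vu uT).
apply: le_trans (B_le_f vT'); apply: B_ge => //.
by apply/ltW; exact: lt_trans us.
Unshelve. all: by end_near. Qed.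

Let m_ge0 u : 0 < u < T -> 0 <= m u.
Proof.
move=> /andP[u0 uT]; have u2 : 0 < u / 2 < T by lra.
by have [a _] := AB0 u2; apply: le_trans a _; apply: A_le_m; lra.
Qed.

Lemma monotone_sum_cvg0 : cvg ((f t)%:E @[t --> 0^'+]).
Proof.
have /cvg_ex[l cl] : cvg ((A s + B s)%:E @[s --> 0^'+]).
  apply: (monotone_sum_right_cvg T0) => [x y|x|x y]; rewrite !in_itv/=.
  - by move=> ? ? ?; apply: A_le; lra.
  - by move=> xT; have [] := AB0 xT.
  - by move=> ? ? ?; apply: B_ge; lra.
apply/cvg_ex; exists l; apply: cvg_trans cl; apply: near_eq_cvg; near=> s.
rewrite fE//; apply/andP; split; first by near: s; exact: nbhs_right_gt.
by near: s; exact: nbhs_right_lt.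
Unshelve. all: by end_near. Qed.

(** The reflection of the line about [0] exchanges the roles of [A] and [B]. *)
Lemma monotone_sum_cvgT : cvg ((f t)%:E @[t --> T^'-]).
Proof.
have NT0 : - T < 0 by rewrite oppr_lt0.
have /cvg_ex[l cl] : cvg ((B (- s) + A (- s))%:E @[s --> (- T)^'+]).
  apply: (@monotone_sum_right_cvg _ _ 0 (B \o -%R) (A \o -%R)) => // [x y|x|x y];
    rewrite !in_itv/=.
  - by move=> ? ? ?; apply: B_ge; lra.
  - move=> xT; have xT' : 0 < - x < T by lra.
    by have [] := AB0 xT'.
  - by move=> ? ? ?; apply: A_le; lra.
apply/cvg_ex; exists l; apply/cvg_at_leftNP.
apply: cvg_trans cl; apply: near_eq_cvg; near=> s => /=.
have s0 : s < 0 by near: s; exact: nbhs_right_lt.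
have sT : - T < s by near: s; exact: nbhs_right_gt.
have sT' : 0 < - s < T by lra.
by rewrite (fE sT') (addrC (A _)).
Unshelve. all: by end_near. Qed.

Let B_le_f0 s : 0 < s -> s < T -> ((B s)%:E <= f0)%E.
Proof.
move=> s0 sT; apply: lime_ge; first exact: monotone_sum_cvg0.
near=> v; have v0 : 0 < v by near: v; exact: nbhs_right_gt.
have vs : v < s by near: v; exact: nbhs_right_lt.
have vT : 0 < v < T by rewrite v0 (lt_trans vs).
by rewrite lee_fin; apply: le_trans (B_le_f vT); apply: B_ge => //; exact: ltW.
Unshelve. all: by end_near. Qed.

Let A_le_fT s : 0 < s -> s < T -> ((A s)%:E <= fT)%E.
Proof.
move=> s0 sT; apply: lime_ge; first exact: monotone_sum_cvgT.
near=> v; have sv : s < v by near: v; exact: nbhs_left_gt.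
have vT : v < T by near: v; exact: nbhs_left_lt.
have vT' : 0 < v < T by rewrite vT (lt_trans s0).
by rewrite lee_fin; apply: le_trans (A_le_f vT'); apply: A_le => //; exact: ltW.
Unshelve. all: by end_near. Qed.

(** The increments of [psi] telescope, so only the extreme points of the sequence remain. It is used
    with [psi] equal to [A - B] for the total, [A] for the positive and [- B] for the negative
    variation. *)
Let open_variation_le (phi psi : R -> R) a b (c : \bar R) : 0 <= a -> b <= T ->
  (forall x y, a < x -> x < y -> y < b -> phi (f y - f x) <= psi y - psi x) ->
  (0 <= c)%E ->
  (forall x y, a < x -> x <= y -> y < b -> ((psi y - psi x)%:E <= c)%E) ->
  (open_variation phi a b f <= c)%E.
Proof.
move=> a0 bT phi_psi c0 psi_c; apply: ge_ereal_sup => _ [s [srt sab] <-].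
case: s srt sab => [|x s] srt sab; first by rewrite big_geq.
apply: le_trans (psi_c x (last x s) _ _ _); last 3 first.
- by have /andP[] := sab x (mem_head _ _).
- have := order_path_min lt_trans srt; move=> /allP xs.
  by have := mem_last x s; rewrite inE => /predU1P[->//|/xs /ltW].
- by have /andP[] := sab _ (mem_last x s).
rewrite lee_fin /= -[last x s](nth_last 0 (x :: s)) /=.
have -> : psi (nth 0 (x :: s) (size s)) - psi x =
    \sum_(0 <= i < size s) (psi (nth 0 (x :: s) i.+1) - psi (nth 0 (x :: s) i)).
  by rewrite (telescope_sumr (fun i => psi (nth 0 (x :: s) i))).
apply: ler_sum_nat => i /andP[_ si]; apply: phi_psi.
- by have /andP[] := sab _ (mem_nth 0 (leqW si : (i < size (x :: s))%N)).
- by have /(pathP 0) := srt; apply.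
- by have /andP[] := sab _ (mem_nth 0 (si : (i.+1 < size (x :: s))%N)).
Qed.

Let TVo_le a b (c : \bar R) : 0 <= a -> b <= T -> (0 <= c)%E ->
  (forall x y, a < x -> x <= y -> y < b -> ((A y + B x)%:E <= c)%E) ->
  (TVo a b f <= c)%E.
Proof.
move=> a0 bT c0 ABc; apply: (@open_variation_le _ (fun t => A t - B t)) => //.
- move=> x y ax xy yb.
  have xT : 0 < x < T by lra. have yT : 0 < y < T by lra.
  have : A x <= A y by apply: A_le; lra.
  have : B y <= B x by apply: B_ge; lra.
  move=> ? ?.
  by rewrite !fE// ler_norml; lra.
- move=> x y ax xy yb; apply: le_trans (ABc x y ax xy yb); rewrite lee_fin.
  have xT : 0 < x < T by lra. have yT : 0 < y < T by lra.
  by have [? ?] := AB0 xT; have [? ?] := AB0 yT; lra.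
Qed.

Lemma monotone_sum_TVo t1 t2 : 0 < t1 -> t1 < t2 -> t2 < T ->
  (TVo t1 t2 f < +oo)%E /\ (TVo t1 t2 f <= (m t1 + m t2)%:E)%E.
Proof.
move=> t10 t12 t2T.
suff le1 : (TVo t1 t2 f <= (m t1 + m t2)%:E)%E.
  by split=> //; exact: le_lt_trans le1 (ltry _).
apply: TVo_le; [exact: ltW|exact: ltW| |].
  by rewrite lee_fin addr_ge0// m_ge0; lra.
move=> x y t1x xy yt2; rewrite lee_fin addrC lerD//.
  by apply: B_le_m; lra.
by apply: A_le_m; lra.
Qed.

Lemma monotone_sum_TVo_pos e : 0 < e < T ->
  (TVo_pos 0 e f < +oo)%E /\ (TVo_pos 0 e f <= (m e)%:E)%E.
Proof.
move=> eT; have [e0 eT'] := andP eT.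
suff le1 : (TVo_pos 0 e f <= (m e)%:E)%E.
  by split=> //; exact: le_lt_trans le1 (ltry _).
apply: (@open_variation_le _ A) => //; first exact: ltW.
- move=> x y x0 xy ye; rewrite ge_max subr_ge0 A_le// ?andbT; [|lra|lra].
  rewrite !fE; [|lra|lra].
  have : B y <= B x by apply: B_ge; lra.
  lra.
- by rewrite lee_fin m_ge0.
- move=> x y x0 xy ye; rewrite lee_fin; have xT : 0 < x < T by lra.
  have [? _] := AB0 xT.
  have : A y <= m e by apply: A_le_m; lra.
  lra.
Qed.

Lemma monotone_sum_TVo_neg e : 0 < e < T ->
  (TVo_neg (T - e) T f < +oo)%E /\ (TVo_neg (T - e) T f <= (m (T - e))%:E)%E.
Proof.
move=> eT; have [e0 eT'] := andP eT.
suff le1 : (TVo_neg (T - e) T f <= (m (T - e))%:E)%E.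
  by split=> //; exact: le_lt_trans le1 (ltry _).
apply: (@open_variation_le _ (fun t => - B t)) => //; first lra.
- move=> x y x0 xy ye; rewrite ge_max !fE; [|lra|lra].
  have : B y <= B x by apply: B_ge; lra.
  have : A x <= A y by apply: A_le; lra.
  by move=> ? ?; apply/andP; split; lra.
- by rewrite lee_fin m_ge0//; lra.
- move=> x y x0 xy ye; rewrite lee_fin; have yT : 0 < y < T by lra.
  have [_ ?] := AB0 yT.
  have : B x <= m (T - e) by apply: B_le_m; lra.
  lra.
Qed.

Let variation_ge a b x y : a < x -> x < y -> y < b ->
  ((`|f y - f x|)%:E <= TVo a b f)%E.
Proof.
move=> ax xy yb; apply: ereal_sup_ubound; exists [:: x; y] => /=.
  split; first by rewrite xy.
  by move=> z; rewrite !inE => /orP[] /eqP ->; apply/andP; split; lra.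
by rewrite big_nat1.
Qed.

(** The upper bound uses [B x <= f0] and [A y <= m e]. *)
Lemma monotone_sum_left_endpoint :
  ((f0 < +oo)%E <-> exists e, 0 < e < T /\ (TVo 0 e f < +oo)%E) /\
  ((f0 < +oo)%E <-> forall e, 0 < e < T -> (TVo 0 e f < +oo)%E) /\
  ((f0 < +oo)%E -> forall e, 0 < e < T -> (TVo 0 e f <= f0 + (m e)%:E)%E).
Proof.
have le1 e : 0 < e < T -> (TVo 0 e f <= f0 + (m e)%:E)%E.
  move=> eT; have [e0 eT'] := andP eT.
  apply: TVo_le => //; first exact: ltW.
    rewrite adde_ge0//; last by rewrite lee_fin m_ge0.
    have e2 : 0 < e / 2 < T by lra.
    have [e20 e2T] := andP e2; apply: le_trans (B_le_f0 e20 e2T).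
    by rewrite lee_fin; have [] := AB0 e2.
  move=> x y x0 xy ye; rewrite EFinD addeC; apply: leeD.
    by apply: B_le_f0; lra.
  by rewrite lee_fin; apply: A_le_m; lra.
have lty e : (f0 < +oo)%E -> 0 < e < T -> (TVo 0 e f < +oo)%E.
  move=> f0y eT; apply: le_lt_trans (le1 _ eT) _.
  by rewrite lte_add_pinfty// ltry.
(* Conversely [f v <= f (e / 2) + TVo 0 e f] for every [v < e / 2], which bounds the limit at
   [0]. *)
have fin e : 0 < e < T -> (TVo 0 e f < +oo)%E -> (f0 < +oo)%E.
  move=> eT TVy; apply: (@le_lt_trans _ _ ((f (e / 2))%:E + TVo 0 e f)%E).
    apply: lime_le; first exact: monotone_sum_cvg0.
    near=> v; have v0 : 0 < v by near: v; exact: nbhs_right_gt.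
    have ve : v < e / 2 by near: v; apply: nbhs_right_lt; lra.
    apply: le_trans (leeD (lexx _) (variation_ge v0 ve _)); last lra.
    rewrite -EFinD lee_fin -lerBlDl.
    by rewrite distrC ler_norm.
  by rewrite lte_add_pinfty// ltry.
have T2 : 0 < T / 2 < T by move: T0; lra.
split; last split=> //.
- by split=> [?|[e [eT]]]; [exists (T / 2); split => //; exact: lty|exact: fin].
- by split=> [? e ?|TVy]; [exact: lty|apply: (fin (T / 2)) => //; exact: TVy].
Unshelve. all: by end_near. Qed.

Lemma monotone_sum_right_endpoint :
  ((fT < +oo)%E <-> exists e, 0 < e < T /\ (TVo (T - e) T f < +oo)%E) /\
  ((fT < +oo)%E <-> forall e, 0 < e < T -> (TVo (T - e) T f < +oo)%E) /\
  ((fT < +oo)%E -> forall e, 0 < e < T ->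
    (TVo (T - e) T f <= (m (T - e))%:E + fT)%E).
Proof.
have le1 e : 0 < e < T -> (TVo (T - e) T f <= (m (T - e))%:E + fT)%E.
  move=> eT; have [e0 eT'] := andP eT.
  apply: TVo_le => //; first lra.
    rewrite adde_ge0//; first by rewrite lee_fin m_ge0//; lra.
    have e2 : 0 < e / 2 < T by lra.
    have [e20 e2T] := andP e2; apply: le_trans (A_le_fT e20 e2T).
    by rewrite lee_fin; have [] := AB0 e2.
  move=> x y x0 xy ye; rewrite addrC EFinD; apply: leeD.
    by rewrite lee_fin; apply: B_le_m; lra.
  by apply: A_le_fT; lra.
have lty e : (fT < +oo)%E -> 0 < e < T -> (TVo (T - e) T f < +oo)%E.
  move=> fTy eT; apply: le_lt_trans (le1 _ eT) _.
  by rewrite lte_add_pinfty// ltry.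
have fin e : 0 < e < T -> (TVo (T - e) T f < +oo)%E -> (fT < +oo)%E.
  move=> eT TVy.
  apply: (@le_lt_trans _ _ ((f (T - e / 2))%:E + TVo (T - e) T f)%E).
    apply: lime_le; first exact: monotone_sum_cvgT.
    near=> v; have vT : v < T by near: v; exact: nbhs_left_lt.
    have ev : T - e / 2 < v by near: v; apply: nbhs_left_gt; lra.
    have eTe : T - e < T - e / 2 by lra.
    apply: le_trans (leeD (lexx _) (variation_ge eTe ev vT)).
    by rewrite -EFinD lee_fin -lerBlDl ler_norm.
  by rewrite lte_add_pinfty// ltry.
have T2 : 0 < T / 2 < T by move: T0; lra.
split; last split=> //.
- by split=> [?|[e [eT]]]; [exists (T / 2); split => //; exact: lty|exact: fin].
- by split=> [? e ?|TVy]; [exact: lty|apply: (fin (T / 2)) => //; exact: TVy].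
Unshelve. all: by end_near. Qed.

End monotone_sum.

(** * Regularity of the distribution function of the leftmost location *)

Section tau_cdf.
Context d (Omega : measurableType d) (R : realType) (P : probability Omega R).
Variables (X : usc_process Omega R) (T : R).
Hypotheses (hX : stationary P X) (T0 : 0 < T).

Local Notation F := (tau_cdf P X T).

Lemma tau_cdf_nd x y : x <= y -> F x <= F y.
Proof.
by move=> xy; rewrite fine_le ?fin_num_measure//; exact: cdf_nondecreasing.
Qed.

Lemma tau_law_itv x y : x <= y -> tau_law P X T `]x, y]%classic = (F y - F x)%:E.
Proof.
move=> xy; rewrite /tau_cdf /cdf -/(tau_law P X T).
have D := @prD_sub _ _ _ (distribution P (tau X T : {RV P >-> R}))
  `]-oo, x]%classic `]-oo, y]%classic.
rewrite -[RHS]/((pr (distribution P (tau X T : {RV P >-> R})) `]-oo, y]%classic -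
  pr (distribution P (tau X T : {RV P >-> R})) `]-oo, x]%classic)%:E).
rewrite -D//; last by move=> t; rewrite /= !in_itv/= => /le_trans; exact.
rewrite prK//; last exact: measurableD.
congr (distribution _ _ _); apply/seteqP; split => t /=; rewrite !in_itv/=.
  by move=> /andP[xt ->]; split => //; apply/negP; rewrite -ltNge.
by move=> [-> /negP]; rewrite -ltNge => ->.
Qed.

Lemma tau_cdf_cont x : 0 < x < T -> F y @[y --> x] --> F x.
Proof.
(* Points within [c] of [x] stay at distance more than [c] from [0] and [T], so [tau_cdf_bound]
   makes [F] Lipschitz there with constant [1 / c]. *)
move=> xT; pose c := Num.min x (T - x) / 4.
have [c0 cx cT] : [/\ 0 < c, 2 * c < x & 2 * c < T - x].
  rewrite /c; have : 0 < Num.min x (T - x) by rewrite lt_min; lra.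
  have : Num.min x (T - x) <= x by rewrite ge_min lexx.
  have : Num.min x (T - x) <= T - x by rewrite ge_min lexx orbT.
  by move=> *; split; lra.
have lip y z : x - c < y -> y <= z -> z < x + c -> (F z - F y) * c <= z - y.
  move=> xy yz zx; move: yz; rewrite le_eqVlt => /predU1P[->|yz].
    by rewrite !subrr mul0r.
  have zy : 0 < z - y by lra.
  have := tau_cdf_bound hX zy (_ : 0 <= y) (_ : y + (z - y) <= T).
  rewrite subrKC => /(_ ltac:(lra) ltac:(lra)); apply: le_trans.
  apply: ler_wpM2l; first by rewrite subr_ge0 tau_cdf_nd// ltW.
  by rewrite le_min; lra.
apply/cvgrPdist_le => eps eps0.
have k0 : 0 < Num.min c (c * eps) by rewrite lt_min c0 mulr_gt0.
have near_x : \forall y \near x, `|x - y| < Num.min c (c * eps).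
  by apply/nbhs_ballP; exists (Num.min c (c * eps)).
near=> y.
have : `|x - y| < Num.min c (c * eps) by near: y.
rewrite lt_min => /andP[].
have [xy|/ltW yx] := leP x y.
  have := tau_cdf_nd xy; have := lip x y.
  rewrite distrC ger0_norm ?subr_ge0// distrC => lipxy Fxy h1 h2.
  rewrite ger0_norm ?subr_ge0// -(ler_pM2r c0).
  by apply: le_trans (lipxy _ _ _) _; lra.
have := tau_cdf_nd yx; have := lip y x.
rewrite ger0_norm ?subr_ge0// => lipxy Fxy h1 h2.
rewrite ger0_norm ?subr_ge0// -(ler_pM2r c0).
by apply: le_trans (lipxy _ _ _) _; lra.
Unshelve. all: by end_near. Qed.

(** Divide [tau_cdf_bound] by its step and let the step tend to [0]. *)
Lemma right_quotient_bound t : 0 < t < T ->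
  right_derivable F t -> right_derivative F t <= Num.max (1 / t) (1 / (T - t)).
Proof.
move=> /andP[t0 tT] cvF.
have mn0 : 0 < Num.min t (T - t) by rewrite lt_min t0 subr_gt0.
suff : right_derivative F t * Num.min t (T - t) <= 1.
  rewrite -ler_pdivlMr// => /le_trans; apply.
  by rewrite le_max /Num.min; case: ifP => _; rewrite lexx ?orbT.
have c1 : right_quotient F t h * Num.min t (T - t - h) @[h --> 0^'+] -->
    right_derivative F t * Num.min t (T - t - 0).
  apply: cvgM => //.
  apply: cvg_at_right_filter.
  apply: (@continuous_min _ _ (fun=> t) (fun h => T - t - h) 0).
    exact: cvg_cst.
  by apply: cvgB; [exact: cvg_cst|exact: cvg_id].
rewrite -[T - t]subr0; apply: (@ler_cvg_to _ _ _ _ _ (fun=> 1) _ _ c1).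
  exact: cvg_cst.
near=> h; have h0 : 0 < h by near: h; exact: nbhs_right_gt.
have hT : h < T - t by near: h; apply: nbhs_right_lt; rewrite subr_gt0.
rewrite /right_quotient -mulrA ler_pdivrMl// mulr1.
by apply: (tau_cdf_bound hX h0); lra.
Unshelve. all: by end_near. Qed.

Lemma right_quotient_seq t c : 0 < c -> right_derivable F t ->
  right_quotient F t (c / n.+1%:R) @[n --> \oo] --> right_derivative F t.
Proof.
move=> c0 cvF; apply: ((cvg_at_rightP _ 0 _).1 cvF (fun n => c / n.+1%:R)).
split=> [n|]; first by rewrite divr_gt0.
rewrite -[X in _ --> X](mulr0 c); apply: cvgM; first exact: cvg_cst.
exact: cvg_harmonic.
Qed.

(** A pointwise limit of difference quotients of the monotone, hence measurable, [F]. *)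
Lemma measurable_right_derivative :
  (forall t, 0 < t < T -> right_derivable F t) ->
  measurable_fun `]0, T[ (right_derivative F).
Proof.
move=> cvF.
apply: (@measurable_fun_cvg _ _ _ _
  (fun n t => right_quotient F t (1 / n.+1%:R))); last first.
  by move=> t; rewrite /= in_itv/= => /cvF; exact: right_quotient_seq.
have mF : measurable_fun [set: R] F.
  by apply: nondecreasing_measurable => // x y; exact: tau_cdf_nd.
move=> n; apply: measurable_funTS; apply: measurable_funM => //.
apply: measurable_funB => //; apply: measurableT_comp => //.
exact: measurable_funD.
Qed.

(** A derivative below [g / T] at [t] gives, for a fine enough mesh [T / n.+1], a cell of the kind
    excluded by [no_small_cell]. *)
Lemma right_derivative_inf_gt0 :
  (forall t, 0 < t < T -> right_derivable F t) ->
  (forall t, 0 < t < T -> 0 <= right_derivative F t) ->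
  assumption_U P X T -> 0 < inf [set right_derivative F t | t in `]0, T[].
Proof.
move=> cvF f0 hU; rewrite ltNge; apply/negP => inf0.
apply: (no_small_cell hX T0 hU) => g g0.
have hasinf : has_inf [set right_derivative F t | t in `]0, T[].
  split; first by exists (right_derivative F (T / 2)), (T / 2) => //=;
    rewrite in_itv/=; move: T0; lra.
  by exists 0 => _ [t /= + <-]; rewrite in_itv/=; exact: f0.
have gT : 0 < g / T by rewrite divr_gt0.
have [_ [t /= + <-] ft] := inf_adherent gT hasinf.
rewrite in_itv/= => tT; have [t0 tT'] := andP tT.
have {}ft : right_derivative F t < g / T.
  by apply: lt_le_trans ft _; rewrite gerDr.
have ecvg : T / n.+1%:R @[n --> \oo] --> (0 : R).
  rewrite -[X in _ --> X](mulr0 T); apply: cvgM; first exact: cvg_cst.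
  exact: cvg_harmonic.
near \oo => n.
(* Leaves room for two cells to the right of [t]. *)
have eT : T / n.+1%:R < (T - t) / 2.
  by near: n; apply: (cvgr_lt _ ecvg); rewrite divr_gt0// subr_gt0.
have qlt : right_quotient F t (T / n.+1%:R) < g / T.
  by near: n; exact: (cvgr_lt _ (right_quotient_seq T0 (cvF _ tT))).
have e0 : 0 < T / n.+1%:R by rewrite divr_gt0.
have neT : n.+1%:R * (T / n.+1%:R) = T by rewrite mulrC divfK.
move: (T / n.+1%:R) => e in eT qlt e0 neT *.
(* The level is [t + e] because the cell in [no_small_cell] lies to the left of its level. *)
exists (t + e), e, n.+1; split => //; [lra|lra|].
rewrite addrK; move: qlt; rewrite /right_quotient ltr_pdivlMr// => /ltW.
by rewrite -[X in _ * X]neT mulrC -mulrA mulVKf ?lt0r_neq0.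
Unshelve. all: by end_near. Qed.

End tau_cdf.

(** * Properties of the density, assembled from the split [A + B] *)

Unset Implicit Arguments.

Theorem theorem3p1 (d : measure_display) (Omega : measurableType d)
    (R : realType) (P : probability Omega R) (X : usc_process Omega R)
    (hX : stationary P X) (T : R) (hT : 0 < T) :
  let F := tau_law P X T in
  let f := right_derivative (tau_cdf P X T) in
  let m t := Num.min (f t) (left_limit f t) in
  let f0 := lim ((f t)%:E @[t --> 0^'+]) in
  let fT := lim ((f t)%:E @[t --> T^'-]) in
  (mrestr F (measurable_itv `]0, T[) `<< lebesgue_measure) /\
  (forall t, 0 < t < T -> right_derivable (tau_cdf P X T) t) /\
  ((forall t, 0 < t < T -> 0 <= f t) /\
   measurable_fun `]0, T[ f /\
   (forall A : set R, measurable A -> A `<=` `]0, T[ ->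
     F A = (\int[lebesgue_measure]_(t in A) (f t)%:E)%E)) /\
  (forall t, 0 < t < T -> f s @[s --> t^'+] --> f t) /\
  (forall t, 0 < t < T -> cvg (f s @[s --> t^'-])) /\
  (* (a) *)
  (cvg ((f t)%:E @[t --> 0^'+]) /\ cvg ((f t)%:E @[t --> T^'-])) /\
  (* (b) *)
  (forall t, 0 < t < T -> f t <= Num.max (1 / t) (1 / (T - t))) /\
  (* (c) *)
  (assumption_U P X T -> 0 < inf [set f t | t in `]0, T[]) /\
  (* (d) *)
  (forall t1 t2, 0 < t1 -> t1 < t2 -> t2 < T ->
    (TVo t1 t2 f < +oo)%E /\ (TVo t1 t2 f <= (m t1 + m t2)%:E)%E) /\
  (* (e) *)
  (forall e, 0 < e < T ->
    ((TVo_pos 0 e f < +oo)%E /\ (TVo_pos 0 e f <= (m e)%:E)%E) /\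
    ((TVo_neg (T - e) T f < +oo)%E /\
     (TVo_neg (T - e) T f <= (m (T - e))%:E)%E)) /\
  (* (f) *)
  (((f0 < +oo)%E <-> exists e, 0 < e < T /\ (TVo 0 e f < +oo)%E) /\
   ((f0 < +oo)%E <-> forall e, 0 < e < T -> (TVo 0 e f < +oo)%E) /\
   ((f0 < +oo)%E -> forall e, 0 < e < T ->
     (TVo 0 e f <= f0 + (m e)%:E)%E)) /\
  (((fT < +oo)%E <-> exists e, 0 < e < T /\ (TVo (T - e) T f < +oo)%E) /\
   ((fT < +oo)%E <-> forall e, 0 < e < T -> (TVo (T - e) T f < +oo)%E) /\
   ((fT < +oo)%E -> forall e, 0 < e < T ->
     (TVo (T - e) T f <= (m (T - e))%:E + fT)%E)).
Proof.
move=> F f m f0 fT.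
have F_nd x y : 0 <= x -> x <= y -> y <= T ->
    tau_cdf P X T x <= tau_cdf P X T y.
  by move=> _ xy _; exact: tau_cdf_nd.
have [A [B [cvAB right_cont AB0 [A_nd B_ni] F_incr]]] :=
  density_split hT F_nd (tau_cdf_cont hX) (positive_increments hX).
have cvF t : 0 < t < T -> right_derivable (tau_cdf P X T) t.
  by move=> /cvAB c; apply/cvg_ex; eexists; exact: c.
have fE t : 0 < t < T -> f t = A t + B t.
  by move=> /cvAB c; apply: cvg_lim => //; exact: c.
have f_ge0 t : 0 < t < T -> 0 <= f t.
  by move=> tT; rewrite fE//; have [? ?] := AB0 t tT; exact: addr_ge0.
have mf : measurable_fun `]0, T[ f by exact: measurable_right_derivative.
have density (E : set R) : measurable E -> E `<=` `]0, T[ ->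
    F E = (\int[lebesgue_measure]_(t in E) (f t)%:E)%E.
  apply: (law_density hT A_nd B_ni AB0 fE F_incr mf
    (nu := distribution P (tau X T : {RV P >-> R}))).
  by move=> x y _ xy _; exact: tau_law_itv.
split.
  (* Absolute continuity: on a null set the integral of the density vanishes. *)
  apply/null_content_dominatesP => E mE E0; rewrite /mrestr density//.
    apply: null_set_integral.
    - exact: measurableI.
    - by apply/measurable_EFinP; apply: measurable_funS mf => // t [].
    - by apply/eqP; rewrite eq_le measure_ge0 andbT -E0 le_measure ?inE//;
        exact: measurableI.
  exact: measurableI.
split; first exact: cvF.
split; first by split.
split.
  move=> t tT; have [t0 ltT] := andP tT.
  rewrite fE//; apply: cvg_trans (right_cont t tT).
  apply: near_eq_cvg; near=> s; rewrite fE//; apply/andP; split.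
    by apply: lt_trans t0 _; near: s; exact: nbhs_right_gt.
  by near: s; exact: nbhs_right_lt.
split; first by move=> t; exact: (monotone_sum_left_cvg A_nd B_ni fE).
split.
  by split; [exact: (monotone_sum_cvg0 hT A_nd B_ni AB0 fE)|
             exact: (monotone_sum_cvgT hT A_nd B_ni AB0 fE)].
split; first by move=> t tT; exact: (right_quotient_bound hX tT (cvF _ tT)).
split; first exact: (right_derivative_inf_gt0 hX hT cvF f_ge0).
split; first exact: (monotone_sum_TVo A_nd B_ni AB0 fE).
split.
  move=> e eT; split; first exact: (monotone_sum_TVo_pos A_nd B_ni AB0 fE).
  exact: (monotone_sum_TVo_neg A_nd B_ni AB0 fE).
split; first exact: (monotone_sum_left_endpoint hT A_nd B_ni AB0 fE).
exact: (monotone_sum_right_endpoint hT A_nd B_ni AB0 fE).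
Unshelve. all: by end_near. Qed.
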